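(* The function $\widetilde h_2$ for which $$h_2(\mathrm r_1,\Lambda_2,\Theta,\mathrm G_2,\mathrm g_2)=\widetilde h_2\big(\mathrm r_1,\Lambda_2,\Theta,\mathrm E_0(\mathrm r_1,\Lambda_2,\Theta,\mathrm G_2,\mathrm g_2)\big)$$ is given by $$\widetilde h_2(\mathrm r_1,\Lambda_2,\Theta,\mathrm E_0)=\mathrm U\big(\mathrm r_1,a_2,\mathcal E(\Lambda_2,\mathrm E_0),\mathcal I(\Lambda_2,\Theta,\mathrm E_0)\big),$$ where $$\mathrm U(a,b,u,v)=\frac1{2\pi}\int_{\mathbb T}\frac{(1-u\cos w)\,dw}{\sqrt{a^2+b^2-2b(av\sin w+bu\cos w)+b^2u^2\cos^2w}},$$ $$\mathcal E(\Lambda_2,\mathrm E_0)=\frac{\sqrt{\Lambda_2^2-\mathrm E_0}}{\Lambda_2},\qquad \mathcal I(\Lambda_2,\Theta,\mathrm E_0)=\frac{\sqrt{\mathrm E_0-\Theta^2}}{\Lambda_2}.$$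
   Context: Let $(y^{(i)},x^{(i)})\in\mathbb R^3\times\mathbb R^3$, $i=1,2$, and let $\mathrm m_2,\mathrm M_2>0$. Consider points where $\frac{\|y^{(2)}\|^2}{2\mathrm m_2}-\frac{\mathrm m_2\mathrm M_2}{\|x^{(2)}\|}<0$ and the Keplerian ellipse generated by this Hamiltonian through $(y^{(2)},x^{(2)})$ has non-zero eccentricity; $a_2$ is its semi-major axis and $\mathrm P^{(2)}$ the unit direction of its perihelion. Put $\mathrm C^{(2)}=x^{(2)}\times y^{(2)}$, $\Lambda_2=\mathrm m_2\sqrt{\mathrm M_2a_2}$ (so $a_2=\Lambda_2^2/(\mathrm m_2^2\mathrm M_2)$), $\mathrm G_2=\|\mathrm C^{(2)}\|$, $\mathrm r_1=\|x^{(1)}\|$, $\Theta=\mathrm C^{(2)}\cdot x^{(1)}/\|x^{(1)}\|$, and let $\mathrm g_2$ be the angle from $x^{(1)}\times\mathrm C^{(2)}$ to $\mathrm C^{(2)}\times\mathrm P^{(2)}$ (assumed non-zero vectors), oriented by the right-hand rule about $\mathrm C^{(2)}$. These quantities belong to a canonical system $\mathcal K$ in which $\mathrm l_2$ (the mean anomaly of $x^{(2)}$) is conjugate to $\Lambda_2$ and $\mathrm g_2$ is conjugate to $\mathrm G_2$. In these coordinates ($\mathbb T=\mathbb R/2\pi\mathbb Z$) the partially averaged Newtonian potential $h_2=\frac1{2\pi}\int_{\mathbb T}\frac{d\mathrm l_2}{\|x^{(1)}-x^{(2)}\|}$ is $$h_2(\mathrm r_1,\Lambda_2,\Theta,\mathrm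 G_2,\mathrm g_2)=\frac1{2\pi}\int_{\mathbb T}\frac{\varrho_2\,d\zeta_2}{\sqrt{\mathrm r_1^2+2\mathrm r_1a_2\sqrt{1-\frac{\Theta^2}{\mathrm G_2^2}}\Big(\cos\mathrm g_2\big(\cos\zeta_2-\sqrt{1-\tfrac{\mathrm G_2^2}{\Lambda_2^2}}\big)-\frac{\mathrm G_2}{\Lambda_2}\sin\mathrm g_2\sin\zeta_2\Big)+a_2^2\varrho_2^2}},$$ with $\varrho_2=1-\sqrt{1-\mathrm G_2^2/\Lambda_2^2}\cos\zeta_2$, and $$\mathrm E_0(\mathrm r_1,\Lambda_2,\Theta,\mathrm G_2,\mathrm g_2)=\mathrm G_2^2+\mathrm m_2^2\mathrm M_2\mathrm r_1\sqrt{1-\frac{\mathrm G_2^2}{\Lambda_2^2}}\sqrt{1-\frac{\Theta^2}{\mathrm G_2^2}}\cos\mathrm g_2 .$$ ($h_2$ is considered where it is well defined and smooth, i.e. $x^{(1)}$ is not on the ellipse.) $\mathrm U$ is even in $u$ and in $v$, so the right-hand side is a function of $\mathcal E^2$ and $\mathcal I^2$, hence of $\mathrm E_0$. For $\Theta^2\le\mathrm E_0\le\Lambda_2^2$ the quantities $\mathcal E,\mathcal I$ are real and the formula is meant literally; for other values of $\mathrm E_0$ (where $\mathcal E$ or $\mathcal I$ is imaginary) it is understood by real-analytic continuation in $\mathrm E_0$ (by continuity in $\Theta$ at $\Theta=0$). *)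

(* Defs.v *)
(* Stdlib reals with Coquelicot. *)
From Stdlib Require Export Reals.
From Coquelicot Require Export Coquelicot.
Open Scope R_scope.

Section Averaged_potential.

Variables m2 M2 : R.

Definition a2 (L2 : R) : R := L2 ^ 2 / (m2 ^ 2 * M2).

Definition ecc (L2 G2 : R) : R := sqrt (1 - G2 ^ 2 / L2 ^ 2).

(* In terms of the eccentric anomaly zeta of x2, dl2 = rho2 dzeta and
   |x2| = a2 * rho2. *)
Definition rho2 (L2 G2 zeta : R) : R := 1 - ecc L2 G2 * cos zeta.

(* |x1 - x2|^2, where x2 is the point of eccentric anomaly zeta. *)
Definition dist2 (r1 L2 Th G2 g2 zeta : R) : R :=
  r1 ^ 2
  + 2 * r1 * a2 L2 * sqrt (1 - Th ^ 2 / G2 ^ 2)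
    * (cos g2 * (cos zeta - ecc L2 G2) - G2 / L2 * sin g2 * sin zeta)
  + a2 L2 ^ 2 * rho2 L2 G2 zeta ^ 2.

Definition h2 (r1 L2 Th G2 g2 : R) : R :=
  / (2 * PI) *
  RInt (fun zeta => rho2 L2 G2 zeta / sqrt (dist2 r1 L2 Th G2 g2 zeta))
       0 (2 * PI).

Definition E0 (r1 L2 Th G2 g2 : R) : R :=
  G2 ^ 2
  + m2 ^ 2 * M2 * r1 * sqrt (1 - G2 ^ 2 / L2 ^ 2)
    * sqrt (1 - Th ^ 2 / G2 ^ 2) * cos g2.

(* |Th| < G2 says that x1 and the angular momentum C2 are not parallel (and
   C2 <> 0), G2 < L2 that the eccentricity is not zero; these make the angle
   g2 well defined. The last clause says that x1 is not on the ellipse. *)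
Definition admissible (r1 L2 Th G2 g2 : R) : Prop :=
  0 < r1 /\ Rabs Th < G2 /\ G2 < L2 /\
  (forall zeta, 0 < dist2 r1 L2 Th G2 g2 zeta).

Definition E0_value (r1 L2 Th E : R) : Prop :=
  exists G2 g2, admissible r1 L2 Th G2 g2 /\ E0 r1 L2 Th G2 g2 = E.

Definition factors_h2 (ht : R -> R -> R -> R -> R) : Prop :=
  forall r1 L2 Th G2 g2, admissible r1 L2 Th G2 g2 ->
    h2 r1 L2 Th G2 g2 = ht r1 L2 Th (E0 r1 L2 Th G2 g2).

Definition U (a b u v : R) : R :=
  / (2 * PI) *
  RInt (fun w => (1 - u * cos w) /
          sqrt (a ^ 2 + b ^ 2 - 2 * b * (a * v * sin w + b * u * cos w)
                + b ^ 2 * u ^ 2 * cos w ^ 2))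
       0 (2 * PI).

Definition calE (L2 E : R) : R := sqrt (L2 ^ 2 - E) / L2.

Definition calI (L2 Th E : R) : R := sqrt (E - Th ^ 2) / L2.

(* f is, around each point of S, the sum on S of a convergent power series;
   when S is an interval, this says that f restricted to S extends to a
   real-analytic function on an open interval containing S. *)
Definition analytic_on (S : R -> Prop) (f : R -> R) : Prop :=
  forall x0, S x0 ->
  exists (c : nat -> R) (r : R), 0 < r /\
    forall x, S x -> Rabs (x - x0) < r -> is_pseries c (x - x0) (f x).

(* ht is E |-> U (r1, a2, calE, calI): literally where calE and calI are real,
   by real-analytic continuation in E at the other values of E0.
   For Th <> 0 the values of E0 form an interval, on which the first two clauses
   determine ht.  For Th = 0 the collision level E = m2^2 M2 r1 is missing and
   may separate some values from [0, L2^2]; the last clause determines ht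
   there. *)
Definition continued_U (ht : R -> R -> R -> R -> R) : Prop :=
  forall r1 L2, 0 < r1 -> 0 < L2 ->
  (forall Th E, E0_value r1 L2 Th E -> Th ^ 2 <= E <= L2 ^ 2 ->
     ht r1 L2 Th E = U r1 (a2 L2) (calE L2 E) (calI L2 Th E)) /\
  (forall Th, analytic_on (E0_value r1 L2 Th) (ht r1 L2 Th)) /\
  (forall E, E0_value r1 L2 0 E ->
     filterlim (fun Th => ht r1 L2 Th E)
       (within (fun Th => E0_value r1 L2 Th E) (locally' 0))
       (locally (ht r1 L2 0 E))).

End Averaged_potential.

(* Main.v *)
From Stdlib Require Import Lra Lia ClassicalEpsilon Wf_nat.
Require Import Defs.

(** Measure lengths in units of [a2] and actions in units of [L2].  With
    [r = r1 / a2], [th = Th / L2], [E = E0 / L2^2], the eccentricity [e] and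
      [k = sqrt (1 - Th^2 / G2^2)],  [p = k cos g2],  [q = (G2 / L2) k sin g2],
    everything is expressed through
      [gap = r^2 + 2 r (p (cos z - e) - q sin z) + (1 - e cos z)^2],
      [E = 1 - e^2 + r e p],   [q^2 = (1 - e^2) (1 - p^2) - th^2],
    and [h2] is, up to the factor [1 / (2 PI a2)], the integral over a period
    of [(1 - e cos z) / sqrt gap].  Reversing [z] changes [q] into [- q], so on
    a level set of [E], where [p] is a function of [e], the potential is a
    function of [e] alone; it has to be shown constant.

    Locally this is an exactness statement.  The vector field
      [e' = r e q],  [p' = q (2 e - r p)],
      [q' = - r e^2 (1 - p^2) - (1 - e^2) p (2 e - r p)]
    is tangent to the level set, and along it the derivative of
    [(1 - e cos z) / sqrt gap] is the [z]-derivative of the periodic function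
      [r (p - 2 e^2 p + r e + e p cos z - 2 e q sin z) / sqrt gap]
    ([is_derive_density_along_level]), whose integral over a period vanishes.

    Globally, the level set has to be connected.  Up to a positive factor, the
    condition [0 <= q^2] says that a monic cubic in [e^2] is nonnegative
    there; this cubic is nonpositive at [1], so on the unit interval it is
    nonnegative on an interval ([level_Q_pos_between]).  Collisions do not cut
    that interval: [gap] vanishes somewhere exactly if [th = 0] and [E = r], in
    which case the whole level set is excluded ([gap_pos], [gap_collision]).
    So the potential depends on [E] only ([level_potential_constant]).

    For [th^2 <= E <= 1] the closure of the level set contains the point
    [e = sqrt (1 - E)], where [p = 0] and [q^2 = E - th^2]: there the integral
    is, literally, [U r 1 (sqrt (1 - E)) (sqrt (E - th^2))].

    For analyticity in [E], one freezes [e].  Then [p] is affine and [q^2]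
    quadratic in [E].  The square root [q] itself is removed by averaging the
    integrand over [q] and [- q], which leaves an expression in [p] and [q^2]
    built from sums, products and inverse square roots of positive functions;
    it is therefore a power series in [E] with uniform bounds in [z], and can be
    integrated term by term.  Every value of [E] has a level set containing
    an [e] that also serves all neighbouring values ([stable_eccentricity]).
    Finally, if the planar level set contains a point with [0 < q], the limit
    [th -> 0] is taken at fixed [e]; if it contains none, the value [E] is not
    attained for any [th <> 0]. *)

(** * The ellipse and its collisions *)

(** The squared distance [dist2] in units of [a2]: the point of eccentric
    anomaly [z] has coordinates [cos z - e] and [sqrt (1 - e^2) sin z] along the
    axes of the ellipse. *)
Definition gap (r e p q z : R) : R :=
  r ^ 2 + 2 * r * (p * (cos z - e) - q * sin z) + (1 - e * cos z) ^ 2.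

(** For [th <> 0] the outer point is off the plane of the ellipse; in that plane
    the collisions fill the level [E = r]. *)
Definition noncollision (r th E : R) : Prop := th <> 0 \/ E <> r.

Lemma sin2_cos2_pow z : sin z * sin z = 1 - cos z * cos z.
Proof. generalize (sin2_cos2 z); unfold Rsqr; lra. Qed.

Lemma angle_of_circle c s : c ^ 2 + s ^ 2 = 1 ->
  exists z, 0 <= z <= 2 * PI /\ cos z = c /\ sin z = s.
Proof.
intros H.
assert (Hc : -1 <= c <= 1) by nra.
pose proof (acos_bound c) as Hb.
assert (Hs : sin (acos c) = Rabs s).
{ rewrite sin_acos by assumption.
  replace (1 - c²) with (s²) by (unfold Rsqr; nra).
  apply sqrt_Rsqr_abs. }
destruct (Rle_dec 0 s) as [Hp | Hn].
- exists (acos c); rewrite Hs, Rabs_pos_eq, cos_acos by assumption.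
  split; [lra | auto].
- exists (2 * PI - acos c).
  rewrite Rminus_def, Rplus_comm, cos_plus, sin_plus, cos_neg, sin_neg,
    cos_2PI, sin_2PI, Hs, cos_acos, Rabs_left by lra.
  repeat split; lra.
Qed.

(** With [N = 1 - e cos z] the distance to the focus and [y] the factor of
    [2 r], [gap = (r - N)^2 + 2 r (N + y)], and [- N <= y] is the
    Cauchy-Schwarz inequality.  It follows from Lagrange's identity, whose
    remainder consists of [th^2 N^2] (due to the height of the outer point above
    the plane of the ellipse) and of the square of [w].  If [gap] vanishes, so do
    both terms, and then [E = r]. *)
Lemma gap_pos r th e p q z :
  0 < r -> 0 <= e < 1 -> q ^ 2 = (1 - e ^ 2) * (1 - p ^ 2) - th ^ 2 ->
  noncollision r th (1 - e ^ 2 + r * e * p) -> 0 < gap r e p q z.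
Proof.
intros Hr He Hq Hnc.
unfold gap.
pose proof (sin2_cos2_pow z) as Hz.
assert (Hc := COS_bound z).
set (c := cos z) in *; set (s := sin z) in *.
set (N := 1 - e * c); set (y := p * (c - e) - q * s).
set (w := q * (c - e) + (1 - e ^ 2) * s * p).
assert (HN : 0 < N) by (unfold N; nra).
assert (He2 : 0 < 1 - e ^ 2) by nra.
assert (Hlag : (1 - e ^ 2) * (N ^ 2 - y ^ 2) = th ^ 2 * N ^ 2 + w ^ 2).
{ unfold N, y, w.
  assert (Hq' : q * q = (1 - e ^ 2) * (1 - p ^ 2) - th ^ 2) by (rewrite <- Hq; ring).
  ring [Hz Hq']. }
assert (Hy : 0 <= N + y).
{ destruct (Rle_dec 0 (N + y)) as [h | h]; [exact h | exfalso].
  assert (0 < y ^ 2 - N ^ 2) by nra.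
  assert (0 <= th ^ 2 * N ^ 2) by (apply Rmult_le_pos; apply pow2_ge_0).
  pose proof (pow2_ge_0 w). nra. }
destruct (Rlt_dec 0 (r ^ 2 + 2 * r * y + N ^ 2)) as [h | h]; [exact h | exfalso].
assert (HrN : r - N = 0).
{ assert (0 <= r * (N + y)) by nra.
  assert ((r - N) ^ 2 <= 0) by nra. nra. }
assert (HyN : y = - N).
{ assert (r * (N + y) <= 0) by nra. nra. }
rewrite HyN in Hlag.
assert (Hth : th ^ 2 * N ^ 2 = 0 /\ w ^ 2 = 0).
{ assert (0 <= th ^ 2 * N ^ 2) by (apply Rmult_le_pos; apply pow2_ge_0).
  pose proof (pow2_ge_0 w). nra. }
destruct Hth as [Hth Hw].
assert (Hw0 : w = 0) by nra.
assert (Hth0 : th = 0).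
{ assert (th * N = 0) by nra. nra. }
destruct Hnc as [Hnc | Hnc]; [tauto | apply Hnc].
assert (HpN : N * (N * p) = N * (e - c)).
{ replace (N * (N * p)) with ((c - e) * y + s * w) by (unfold N, y, w; ring [Hz]).
  rewrite Hw0, HyN; ring. }
apply Rmult_eq_reg_l in HpN; [| lra].
replace r with N by lra.
replace (1 - e ^ 2 + N * e * p) with (1 - e ^ 2 + e * (N * p)) by ring.
rewrite HpN; unfold N; ring.
Qed.

(** In the planar case, [E = r] puts the outer point on the ellipse: the
    collision takes place at [cos z = e - r p], where the distance to the focus
    is [1 - e cos z = r]. *)
Lemma gap_collision r e p q :
  0 <= e < 1 -> q ^ 2 = (1 - e ^ 2) * (1 - p ^ 2) ->
  1 - e ^ 2 + r * e * p = r -> exists z, gap r e p q z = 0.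
Proof.
intros He Hq Hr.
assert (He2 : 0 < 1 - e ^ 2) by nra.
destruct (angle_of_circle (e - r * p) (r * q / (1 - e ^ 2))) as [z [_ [Hc Hs]]].
{ replace ((r * q / (1 - e ^ 2)) ^ 2) with (r ^ 2 * q ^ 2 / (1 - e ^ 2) ^ 2) by (field; lra).
  rewrite Hq.
  replace (r ^ 2 * ((1 - e ^ 2) * (1 - p ^ 2)) / (1 - e ^ 2) ^ 2)
    with (r ^ 2 * (1 - p ^ 2) / (1 - e ^ 2)) by (field; lra).
  apply Rmult_eq_reg_r with (1 - e ^ 2); [| lra].
  field_simplify; [| lra].
  assert (H2 : r * e * p = r - 1 + e ^ 2) by lra.
  assert (H3 : (r * e * p) ^ 2 = (r - 1 + e ^ 2) ^ 2) by (rewrite H2; reflexivity).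
  nra. }
exists z; unfold gap; rewrite Hc, Hs.
replace (p * (e - r * p - e) - q * (r * q / (1 - e ^ 2)))
  with (- r * p ^ 2 - r * q ^ 2 / (1 - e ^ 2)) by (field; lra).
rewrite Hq.
replace (1 - e * (e - r * p)) with r by lra.
field; lra.
Qed.

(** * The potential of the ellipse as a function of its parameters *)

Lemma tube_pos (g : R -> R -> R) (t0 a b : R) : a <= b ->
  (forall z, a <= z <= b -> continuity_2d_pt g t0 z) ->
  (forall z, a <= z <= b -> 0 < g t0 z) ->
  locally t0 (fun t => forall z, a <= z <= b -> 0 < g t z).
Proof.
intros Hab Hc Hp.
destruct (continuity_ab_min (g t0) a b Hab) as [zm [Hm Hzm]].
{ intros z Hz eps Heps.
  destruct (Hc z Hz (mkposreal eps Heps)) as [d Hd].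
  exists d; split; [apply cond_pos |].
  intros x [_ Hx]; apply (Hd t0 x).
  - rewrite Rminus_diag, Rabs_R0; apply cond_pos.
  - exact Hx. }
assert (Hm0 := Hp zm Hzm).
destruct (uniform_continuity_2d_1d' g a b t0 Hc (mkposreal _ Hm0)) as [d Hd].
exists d; intros t Ht z Hz; simpl in Hd.
change (Rabs (t - t0) < d) in Ht.
assert (Ht' := Rabs_def2 _ _ Ht).
specialize (Hd z t0 z t Hz).
pose proof (cond_pos d).
assert (Rabs (g t z - g t0 z) < g t0 zm).
{ apply Hd; try lra; rewrite Rminus_diag, Rabs_R0; lra. }
specialize (Hm z Hz).
apply Rabs_def2 in H0; lra.
Qed.

Lemma continuous_RInt_param (f : R -> R -> R) (t0 a b : R) : a <= b ->
  (forall z, a <= z <= b -> continuity_2d_pt f t0 z) ->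
  locally t0 (fun t => ex_RInt (f t) a b) ->
  continuous (fun t => RInt (f t) a b) t0.
Proof.
intros Hab Hc Hex.
apply filterlim_locally; intros eps.
assert (He : 0 < eps / (b - a + 1)).
{ apply Rdiv_lt_0_compat; [apply cond_pos | lra]. }
destruct (uniform_continuity_2d_1d' f a b t0 Hc (mkposreal _ He)) as [d Hd].
simpl in Hd.
assert (Hl : locally t0 (fun t => Rabs (t - t0) < d)) by (exists d; intros t Ht; exact Ht).
generalize (filter_and _ _ Hl Hex); apply filter_imp; intros t [Ht Ext].
pose proof (locally_singleton _ _ Hex) as Ex0.
pose proof (cond_pos d).
assert (Ht' := Rabs_def2 _ _ Ht).
change (Rabs (RInt (f t) a b - RInt (f t0) a b) < eps).
rewrite <- (RInt_minus (V := R_CompleteNormedModule)) by assumption.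
apply Rle_lt_trans with ((b - a) * (eps / (b - a + 1))).
- apply (norm_RInt_le_const (V := R_NormedModule) (fun z => f t z - f t0 z) a b); [exact Hab | |].
  + intros z Hz. apply Rlt_le.
    apply (Hd z t0 z t); try lra; rewrite Rminus_diag, Rabs_R0; lra.
  + apply (RInt_correct (V := R_CompleteNormedModule)).
    apply (ex_RInt_minus (V := R_NormedModule)); assumption.
- apply Rmult_lt_reg_r with (b - a + 1); [lra |].
  pose proof (cond_pos eps).
  field_simplify; [nra | lra].
Qed.

Lemma continuity_2d_pt_fst (f : R -> R) t z :
  continuous f t -> continuity_2d_pt (fun u _ => f u) t z.
Proof.
intros H.
apply (continuity_1d_2d_pt_comp f (fun u _ => u)).
- apply continuity_pt_filterlim, H.
- apply continuity_2d_pt_id1.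
Qed.

Lemma continuity_2d_pt_snd (f : R -> R) t z :
  continuous f z -> continuity_2d_pt (fun _ v => f v) t z.
Proof.
intros H.
apply (continuity_1d_2d_pt_comp f (fun _ v => v)).
- apply continuity_pt_filterlim, H.
- apply continuity_2d_pt_id2.
Qed.

Lemma continuity_2d_pt_sqrt (f : R -> R -> R) t z :
  continuity_2d_pt f t z -> continuity_2d_pt (fun u v => sqrt (f u v)) t z.
Proof.
intros H; apply continuity_1d_2d_pt_comp; [| exact H].
apply continuity_pt_filterlim, continuous_sqrt.
Qed.

(** Syntactic decomposition: unification-based application of the continuity
    lemmas would unfold the real operations. *)
Ltac cont_2d :=
  lazymatch goal with
  | |- continuity_2d_pt (fun u v => @?f u v + @?g u v) _ _ =>
      apply (continuity_2d_pt_plus f g); cont_2d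
  | |- continuity_2d_pt (fun u v => @?f u v - @?g u v) _ _ =>
      apply (continuity_2d_pt_minus f g); cont_2d
  | |- continuity_2d_pt (fun u v => - @?f u v) _ _ =>
      apply (continuity_2d_pt_opp f); cont_2d
  | |- continuity_2d_pt (fun u v => @?f u v * @?g u v) _ _ =>
      apply (continuity_2d_pt_mult f g); cont_2d
  | |- continuity_2d_pt (fun u v => @?f u v ^ 2) _ _ =>
      apply (continuity_2d_pt_ext (fun u v => f u v * (f u v * 1)));
        [reflexivity | cont_2d]
  | |- continuity_2d_pt (fun u v => sqrt (@?f u v)) _ _ =>
      apply (continuity_2d_pt_sqrt f); cont_2d
  | |- continuity_2d_pt (fun u v => / (@?f u v)) _ _ =>
      apply (continuity_2d_pt_inv f); [cont_2d |]
  | |- continuity_2d_pt (fun u v => @?f u v / @?g u v) _ _ =>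
      apply (continuity_2d_pt_mult f (fun u v => / g u v));
        [cont_2d | apply (continuity_2d_pt_inv g); [cont_2d |]]
  | |- continuity_2d_pt (fun u v => ?f u) _ _ =>
      apply (continuity_2d_pt_fst f); first [assumption | apply continuous_id]
  | |- continuity_2d_pt (fun u v => cos v) _ _ =>
      apply (continuity_2d_pt_snd cos), continuous_cos
  | |- continuity_2d_pt (fun u v => sin v) _ _ =>
      apply (continuity_2d_pt_snd sin), continuous_sin
  | |- continuity_2d_pt (fun u v => ?c) _ _ => try apply continuity_2d_pt_const
  | |- _ => auto
  end.

Definition ring_density (r e p q z : R) : R :=
  (1 - e * cos z) / sqrt (gap r e p q z).

Definition ring_potential (r e p q : R) : R :=
  RInt (ring_density r e p q) 0 (2 * PI).

Lemma gap_continuous_2d r (e p q : R -> R) t z :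
  continuous e t -> continuous p t -> continuous q t ->
  continuity_2d_pt (fun t z => gap r (e t) (p t) (q t) z) t z.
Proof. intros He Hp Hq; unfold gap; cont_2d. Qed.

Lemma ring_density_continuous_2d r (e p q : R -> R) t z :
  continuous e t -> continuous p t -> continuous q t ->
  0 < gap r (e t) (p t) (q t) z ->
  continuity_2d_pt (fun t z => ring_density r (e t) (p t) (q t) z) t z.
Proof.
intros He Hp Hq Hg; unfold ring_density.
cont_2d; [apply gap_continuous_2d; assumption |].
apply Rgt_not_eq, sqrt_lt_R0, Hg.
Qed.

Lemma continuity_2d_section (f : R -> R -> R) t z :
  continuity_2d_pt f t z -> continuous (f t) z.
Proof.
intros H; apply filterlim_locally; intros eps.
destruct (H eps) as [d Hd]; exists d; intros y Hy.
apply (Hd t y); [rewrite Rminus_diag, Rabs_R0; apply cond_pos | exact Hy].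
Qed.

Lemma two_PI_pos : 0 <= 2 * PI.
Proof. pose proof PI_RGT_0; lra. Qed.

Lemma ex_RInt_ring_density r e p q :
  (forall z, 0 <= z <= 2 * PI -> 0 < gap r e p q z) ->
  ex_RInt (ring_density r e p q) 0 (2 * PI).
Proof.
intros Hg; apply (ex_RInt_continuous (V := R_CompleteNormedModule)).
rewrite Rmin_left, Rmax_right by apply two_PI_pos.
intros z Hz.
apply (continuity_2d_section (fun _ => ring_density r e p q) 0).
apply (ring_density_continuous_2d r (fun _ => e) (fun _ => p) (fun _ => q));
  [apply continuous_const .. | apply Hg, Hz].
Qed.

(** Positivity of [gap] at the one parameter [t] suffices, since by compactness
    it persists for nearby parameters, uniformly in [z]. *)
Lemma ring_potential_continuous r (e p q : R -> R) t :
  continuous e t -> continuous p t -> continuous q t ->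
  (forall z, 0 <= z <= 2 * PI -> 0 < gap r (e t) (p t) (q t) z) ->
  continuous (fun t => ring_potential r (e t) (p t) (q t)) t.
Proof.
intros He Hp Hq Hg; apply continuous_RInt_param.
- apply two_PI_pos.
- intros z Hz; apply ring_density_continuous_2d; auto.
- generalize (tube_pos (fun t z => gap r (e t) (p t) (q t) z) t 0 (2 * PI)).
  intros T. generalize (T two_PI_pos (fun z _ => gap_continuous_2d r e p q t z He Hp Hq) Hg).
  apply filter_imp; intros u Hu; apply ex_RInt_ring_density, Hu.
Qed.

(** Numerator of the function of [z] whose derivative is the rate of change of
    the density along a level of [E]. *)
Definition primitive_num (r e p q z : R) : R :=
  p - 2 * e ^ 2 * p + r * e + e * p * cos z - 2 * e * q * sin z.

Definition primitive_num_dz (r e p q z : R) : R :=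
  - (e * p) * sin z - 2 * e * q * cos z.

Definition gap_dz (r e p q z : R) : R :=
  2 * r * (- p * sin z - q * cos z) + 2 * (1 - e * cos z) * (e * sin z).

(** The [z]-derivative of [primitive_num / (e q sqrt gap)].  Division by [e q]
    is the change from the time of the vector field to the parameter [e], since
    [e' = r e q]. *)
Definition density_rate (r e p q z : R) : R :=
   (primitive_num_dz r e p q z - primitive_num r e p q z * gap_dz r e p q z / (2 * gap r e p q z))
    / (e * q * sqrt (gap r e p q z)).

Lemma density_rate_primitive r e p q z :
  0 < gap r e p q z ->
  is_derive (fun z => primitive_num r e p q z / (e * q * sqrt (gap r e p q z)))
    z (density_rate r e p q z).
Proof.
intros Hg.
destruct (Req_dec (e * q) 0) as [H0 | H0].
- replace (density_rate r e p q z) with 0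
    by (unfold density_rate, Rdiv; rewrite H0, Rmult_0_l, Rinv_0; ring).
  apply is_derive_ext with (fun _ => 0).
  + intros t; rewrite H0, Rmult_0_l; unfold Rdiv; now rewrite Rinv_0, Rmult_0_r.
  + apply (is_derive_const (V := R_NormedModule)).
- assert (Hs := sqrt_lt_R0 _ Hg).
  assert (Hd : is_derive (gap r e p q) z (gap_dz r e p q z)).
  { unfold gap, gap_dz; auto_derive; [exact I | ring]. }
  assert (Ha : is_derive (primitive_num r e p q) z (primitive_num_dz r e p q z)).
  { unfold primitive_num, primitive_num_dz; auto_derive; [exact I | ring]. }
  auto_derive.
  + repeat split; try (eexists; eassumption); auto.
    nra.
  + rewrite (is_derive_unique (fun x : R => gap r e p q x) _ _ Hd), (is_derive_unique (fun x : R => primitive_num r e p q x) _ _ Ha).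
    unfold density_rate.
    set (S := sqrt (gap r e p q z)) in *.
    replace (gap r e p q z) with (S * S) by (apply sqrt_sqrt; lra).
    field. repeat split; try lra; intros E; apply H0; rewrite E; ring.
Qed.

(** The exactness statement behind the theorem.  [P] and [Q] are only required
    to have at [e] the slopes [p' / e'] and [q' / e'] of the vector field; after
    multiplication by a power of [sqrt gap] the claim is an identity between
    trigonometric polynomials. *)
Lemma is_derive_density_along_level r (e p q : R) (P Q : R -> R) z :
  0 < gap r e p q z -> 0 < r -> e <> 0 -> q <> 0 -> P e = p -> Q e = q ->
  is_derive P e ((2 * e - r * p) / (r * e)) ->
  is_derive Q e (- (r * e ^ 2 * (1 - p ^ 2) + (1 - e ^ 2) * p * (2 * e - r * p)) / (r * e * q)) ->
  is_derive (fun e => ring_density r e (P e) (Q e) z) e (density_rate r e p q z).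
Proof.
intros Hg Hr He Hq HP HQ DP DQ.
set (p' := (2 * e - r * p) / (r * e)) in DP.
set (q' := - (r * e ^ 2 * (1 - p ^ 2) + (1 - e ^ 2) * p * (2 * e - r * p)) / (r * e * q)) in DQ.
set (g' := 2 * r * (p' * (cos z - e) - p - q' * sin z) - 2 * (1 - e * cos z) * cos z).
assert (DG : is_derive (fun e => gap r e (P e) (Q e) z) e g').
{ unfold gap; auto_derive.
  - repeat split; eexists; eassumption.
  - rewrite (is_derive_unique (fun x : R => P x) _ _ DP), (is_derive_unique (fun x : R => Q x) _ _ DQ), HP.
    unfold g'; ring. }
set (g := fun e => gap r e (P e) (Q e) z) in DG.
assert (Hge : g e = gap r e p q z) by (unfold g; rewrite HP, HQ; reflexivity).
apply (is_derive_ext (fun e => (1 - e * cos z) / sqrt (g e))); [reflexivity |].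
assert (Hs := sqrt_lt_R0 _ Hg).
auto_derive.
- rewrite Hge; repeat split; [eexists; eassumption | assumption | lra].
- rewrite (is_derive_unique (fun x : R => g x) _ _ DG), Hge.
  unfold density_rate.
  assert (HS2 := sqrt_sqrt (gap r e p q z) (Rlt_le _ _ Hg)).
  set (S := sqrt (gap r e p q z)) in *.
  (* the claim multiplied by [2 r e q S^3] *)
  assert (Key : 2 * ((- (r * e * q) * cos z - r * primitive_num_dz r e p q z) * gap r e p q z)
     = (1 - e * cos z) * (r * e * q * g') - r * primitive_num r e p q z * gap_dz r e p q z).
  { replace (r * e * q * g') with
      (2 * r * (q * (2 * e - r * p) * (cos z - e) - r * e * q * p
        + (r * e ^ 2 * (1 - p ^ 2) + (1 - e ^ 2) * p * (2 * e - r * p)) * sin z)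
        - 2 * (1 - e * cos z) * cos z * (r * e * q))
      by (unfold g', p', q'; field; lra).
    unfold primitive_num, primitive_num_dz, gap_dz, gap.
    pose proof (sin2_cos2_pow z) as Hz.
    ring [Hz]. }
  rewrite <- HS2 in Key |- *.
  clearbody g' S.
  apply Rmult_eq_reg_r with (2 * r * e * q * S ^ 3).
  2: { repeat apply Rmult_integral_contrapositive_currified; try lra; apply pow_nonzero; lra. }
  transitivity (- (r * e * q) * cos z * (S * S) * 2 - (1 - e * cos z) * (r * e * q * g')).
  { field; lra. }
  transitivity (2 * r * primitive_num_dz r e p q z * (S * S) - r * primitive_num r e p q z * gap_dz r e p q z).
  { lra. }
  field; lra.
Qed.

(** * Level curves of the energy *)

(** The solution [p] of [E = 1 - e^2 + r e p].  The quotient is split so that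
    for [E = 1] the formula is continuous at [e = 0]. *)
Definition level_p (r E e : R) : R := ((E - 1) / e + e) / r.

(** The value of [q^2] on the level; its sign decides whether the eccentricity
    [e] occurs on it. *)
Definition level_Q (r th E e : R) : R :=
  (1 - e ^ 2) * (1 - level_p r E e ^ 2) - th ^ 2.

Definition level_potential (r th E e : R) : R :=
  ring_potential r e (level_p r E e) (sqrt (level_Q r th E e)).

Lemma level_p_energy r E e : r <> 0 -> (e = 0 -> E = 1) ->
  1 - e ^ 2 + r * e * level_p r E e = E.
Proof.
intros Hr He; unfold level_p; destruct (Req_dec e 0) as [-> | H].
- rewrite (He eq_refl); ring.
- field; lra.
Qed.

(** The closed level curve.  The circular orbit [e = 0] belongs to it only for
    [E = 1], and the degenerate ellipse [e = 1] only for [E = 0]; both can be the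
    point at which the potential takes the form [U]. *)
Definition on_level (r th E e : R) : Prop :=
  0 <= e <= 1 /\ (e = 0 -> E = 1) /\ (e = 1 -> E = 0) /\ 0 <= level_Q r th E e.

Lemma level_gap_pos r th E e z :
  0 < r -> noncollision r th E -> on_level r th E e ->
  0 < gap r e (level_p r E e) (sqrt (level_Q r th E e)) z.
Proof.
intros Hr Hnc (He & He0 & He1 & HQ).
destruct (Req_dec e 1) as [E1 | E1].
- assert (Hp : level_p r E e = 0) by (unfold level_p; rewrite (He1 E1), E1; field; lra).
  assert (Hq : level_Q r th E e <= 0).
  { unfold level_Q; rewrite E1; pose proof (pow2_ge_0 th); nra. }
  rewrite (sqrt_neg_0 _ Hq), Hp; unfold gap.
  pose proof (pow2_ge_0 (1 - e * cos z)); nra.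
- apply gap_pos with th; try lra.
  + rewrite pow2_sqrt by exact HQ; reflexivity.
  + rewrite level_p_energy; auto; lra.
Qed.

(** [r^2 s q^2] as a polynomial in [s = e^2]. *)
Definition level_cubic (r th E s : R) : R :=
  (1 - s) * (r ^ 2 * s - (s - (1 - E)) ^ 2) - th ^ 2 * r ^ 2 * s.

Lemma level_cubic_Q r th E e : r <> 0 -> (e = 0 -> E = 1) ->
  level_cubic r th E (e ^ 2) = r ^ 2 * e ^ 2 * level_Q r th E e.
Proof.
intros Hr He; pose proof (level_p_energy r E e Hr He) as H.
unfold level_cubic, level_Q.
set (p := level_p r E e) in *; clearbody p; rewrite <- H; ring.
Qed.

(** The third divided difference of a monic cubic is [1].  At the nodes
    [s1 < s < s2 < 1], the values at [s1] and [s2] enter it with negative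
    coefficients and those at [s] and [1] with positive ones, so
    [0 <= K(s1), K(s2)] and [K(1) <= 0] force [0 < K(s)]. *)
Lemma level_cubic_pos_between r th E s1 s s2 :
  s1 < s < s2 -> s2 < 1 ->
  0 <= level_cubic r th E s1 -> 0 <= level_cubic r th E s2 ->
  0 < level_cubic r th E s.
Proof.
intros Hs H2 K1 K2.
assert (KE : level_cubic r th E 1 <= 0).
{ unfold level_cubic; pose proof (pow2_ge_0 (th * r)); nra. }
assert (Hlag : level_cubic r th E s * ((s2 - s1) * (1 - s1) * (1 - s2))
  = (s - s1) * (s2 - s) * (1 - s) * ((s2 - s1) * (1 - s1) * (1 - s2))
  + level_cubic r th E s1 * ((s2 - s) * (1 - s) * (1 - s2))
  + level_cubic r th E s2 * ((s - s1) * (1 - s) * (1 - s1))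
  + (- level_cubic r th E 1) * ((s - s1) * (s2 - s) * (s2 - s1))).
{ unfold level_cubic; ring. }
assert (Hp : forall x y, 0 < x -> 0 < y -> 0 < x * y) by (intros; now apply Rmult_lt_0_compat).
apply Rmult_lt_reg_r with ((s2 - s1) * (1 - s1) * (1 - s2)).
{ repeat apply Hp; lra. }
rewrite Rmult_0_l, Hlag.
assert (0 < (s - s1) * (s2 - s) * (1 - s) * ((s2 - s1) * (1 - s1) * (1 - s2)))
  by (repeat apply Hp; lra).
assert (0 <= level_cubic r th E s1 * ((s2 - s) * (1 - s) * (1 - s2))).
{ apply Rmult_le_pos; [assumption |]; apply Rlt_le; repeat apply Hp; lra. }
assert (0 <= level_cubic r th E s2 * ((s - s1) * (1 - s) * (1 - s1))).
{ apply Rmult_le_pos; [assumption |]; apply Rlt_le; repeat apply Hp; lra. }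
assert (0 <= (- level_cubic r th E 1) * ((s - s1) * (s2 - s) * (s2 - s1))).
{ apply Rmult_le_pos; [lra |]; apply Rlt_le; repeat apply Hp; lra. }
lra.
Qed.

Lemma level_Q_pos_between r th E e1 e e2 :
  0 < r -> on_level r th E e1 -> on_level r th E e2 -> e1 < e < e2 ->
  0 < level_Q r th E e.
Proof.
intros Hr (H1 & H10 & _ & HQ1) (H2 & H20 & H21 & HQ2) He.
assert (K1 : 0 <= level_cubic r th E (e1 ^ 2)).
{ rewrite level_cubic_Q by (auto; lra).
  apply Rmult_le_pos; [| exact HQ1]; apply Rmult_le_pos; apply pow2_ge_0. }
assert (K2 : 0 <= level_cubic r th E (e2 ^ 2)).
{ rewrite level_cubic_Q by (auto; lra).
  apply Rmult_le_pos; [| exact HQ2]; apply Rmult_le_pos; apply pow2_ge_0. }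
assert (Hs : e1 ^ 2 < e ^ 2 < e2 ^ 2) by nra.
assert (K : 0 < level_cubic r th E (e ^ 2)).
{ destruct (Req_dec e2 1) as [E2 | E2].
  - (* two of the nodes coincide, but then [E = 0], [th = 0] and the other
       factor of the cubic is increasing *)
    assert (E_0 := H21 E2).
    assert (Hth : th = 0).
    { unfold level_Q in HQ2; rewrite E2 in HQ2; nra. }
    rewrite E2 in *; subst E; subst th; unfold level_cubic in *.
    set (s1 := e1 ^ 2) in *; set (s := e ^ 2) in *.
    assert (0 <= s1) by (apply pow2_ge_0).
    assert (0 <= r ^ 2 * s1 - (s1 - 1) ^ 2).
    { destruct (Rle_dec 0 (r ^ 2 * s1 - (s1 - 1) ^ 2)); [assumption | exfalso].
      assert (0 < (1 - s1) * - (r ^ 2 * s1 - (s1 - 1) ^ 2)) by (apply Rmult_lt_0_compat; lra).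
      nra. }
    assert (0 < r ^ 2 * s - (s - 1) ^ 2).
    { assert (0 < r ^ 2 * (s - s1)) by (apply Rmult_lt_0_compat; [apply pow_lt |]; lra).
      nra. }
    assert (0 < (1 - s) * (r ^ 2 * s - (s - 1) ^ 2)) by (apply Rmult_lt_0_compat; lra).
    lra.
  - apply level_cubic_pos_between with (e1 ^ 2) (e2 ^ 2); auto; nra. }
rewrite level_cubic_Q in K by lra.
apply Rmult_lt_reg_l with (r ^ 2 * e ^ 2).
- apply Rmult_lt_0_compat; apply pow_lt; lra.
- lra.
Qed.

Lemma is_derive_level_p r E e : 0 < r -> 0 < e ->
  is_derive (level_p r E) e ((2 * e - r * level_p r E e) / (r * e)).
Proof.
intros Hr He; unfold level_p; auto_derive; [lra | field; lra].
Qed.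

Lemma is_derive_level_q r th E e : 0 < r -> 0 < e -> 0 < level_Q r th E e ->
  let p := level_p r E e in
  is_derive (fun e => sqrt (level_Q r th E e)) e
   (- (r * e ^ 2 * (1 - p ^ 2) + (1 - e ^ 2) * p * (2 * e - r * p))
     / (r * e * sqrt (level_Q r th E e))).
Proof.
intros Hr He HQ p.
pose proof (is_derive_level_p r E e Hr He) as Dp.
assert (DQ : is_derive (level_Q r th E) e
  (- 2 * (r * e ^ 2 * (1 - p ^ 2) + (1 - e ^ 2) * p * (2 * e - r * p)) / (r * e))).
{ unfold level_Q; auto_derive.
  - repeat split; eexists; exact Dp.
  - rewrite (is_derive_unique (fun x : R => level_p r E x) _ _ Dp).
    fold p; field; lra. }
assert (Hs := sqrt_lt_R0 _ HQ).
auto_derive.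
- repeat split; [eexists; exact DQ | exact HQ].
- rewrite (is_derive_unique (fun x : R => level_Q r th E x) _ _ DQ).
  field; lra.
Qed.

Lemma continuous_level_p r E e : 0 < r -> (e = 0 -> E = 1) ->
  continuous (level_p r E) e.
Proof.
intros Hr He.
destruct (Req_dec e 0) as [H | H].
- apply continuous_ext with (fun x => x / r).
  + intros x; unfold level_p; rewrite (He H).
    change (x / r = ((1 - 1) / x + x) / r); unfold Rdiv; ring.
  + apply (ex_derive_continuous (V := R_NormedModule)); auto_derive; exact I.
- apply (ex_derive_continuous (V := R_NormedModule)).
  unfold level_p; auto_derive; repeat split; lra.
Qed.

Lemma continuous_level_Q r th E e : 0 < r -> (e = 0 -> E = 1) ->
  continuous (level_Q r th E) e.
Proof.
intros Hr He.
apply (continuous_minus (V := R_NormedModule)); [| apply continuous_const].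
apply (continuous_mult (K := R_AbsRing)).
- apply (ex_derive_continuous (V := R_NormedModule)); auto_derive; exact I.
- apply (continuous_comp (level_p r E) (fun p => 1 - p ^ 2)).
  + now apply continuous_level_p.
  + apply (ex_derive_continuous (V := R_NormedModule)); auto_derive; exact I.
Qed.

Lemma gap_dz_continuous_2d r (e p q : R -> R) t z :
  continuous e t -> continuous p t -> continuous q t ->
  continuity_2d_pt (fun t z => gap_dz r (e t) (p t) (q t) z) t z.
Proof. intros He Hp Hq; unfold gap_dz; cont_2d. Qed.

Lemma density_rate_continuous_2d r (e p q : R -> R) t z :
  continuous e t -> continuous p t -> continuous q t ->
  0 < gap r (e t) (p t) (q t) z -> e t <> 0 -> q t <> 0 ->
  continuity_2d_pt (fun t z => density_rate r (e t) (p t) (q t) z) t z.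
Proof.
intros Ce Cp Cq Hg He Hq; unfold density_rate, primitive_num, primitive_num_dz.
assert (G := gap_continuous_2d r e p q t z Ce Cp Cq).
assert (G' := gap_dz_continuous_2d r e p q t z Ce Cp Cq).
assert (Hs := sqrt_lt_R0 _ Hg).
cont_2d; try exact G; try exact G'.
- lra.
- repeat apply Rmult_integral_contrapositive_currified; lra.
Qed.

(** Differentiation under the integral turns the density into a derivative of
    a [2 PI]-periodic function. *)
Lemma level_potential_stationary r th E e :
  0 < r -> noncollision r th E -> 0 < e < 1 -> 0 < level_Q r th E e ->
  is_derive (level_potential r th E) e 0.
Proof.
intros Hr Hnc He HQ.
set (q := fun e => sqrt (level_Q r th E e)).
set (f := fun e z => ring_density r e (level_p r E e) (q e) z).
set (df := fun e z => density_rate r e (level_p r E e) (q e) z).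
assert (Hgap : forall x z, 0 < x < 1 -> 0 < level_Q r th E x ->
  0 < gap r x (level_p r E x) (q x) z).
{ intros x z Hx HQx; apply (level_gap_pos r th); auto.
  repeat split; lra. }
assert (Hloc : locally e (fun x => 0 < x < 1 /\ 0 < level_Q r th E x)).
{ apply filter_and.
  - exact (open_and _ _ (open_gt 0) (open_lt 1) e He).
  - assert (C : continuous (level_Q r th E) e) by (apply continuous_level_Q; lra).
    exact (C (fun y => 0 < y) (open_gt 0 _ HQ)). }
assert (Hdf : forall x z, 0 < x < 1 /\ 0 < level_Q r th E x ->
  is_derive (fun x => f x z) x (df x z)).
{ intros x z [Hx HQx].
  apply (is_derive_density_along_level r x (level_p r E x) (q x) (level_p r E) q z); auto.
  - lra.
  - apply Rgt_not_eq, sqrt_lt_R0, HQx.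
  - apply is_derive_level_p; lra.
  - apply is_derive_level_q; lra. }
assert (Cq : continuous q e).
{ apply (continuous_comp (level_Q r th E) sqrt).
  - apply continuous_level_Q; lra.
  - apply continuous_sqrt. }
assert (Cp : continuous (level_p r E) e) by (apply continuous_level_p; lra).
assert (Hq : q e <> 0) by (apply Rgt_not_eq, sqrt_lt_R0, HQ).
replace 0 with (RInt (fun z => Derive (fun x => f x z) e) 0 (2 * PI)).
- apply (is_derive_RInt_param f 0 (2 * PI) e).
  + revert Hloc; apply filter_imp; intros x Hx z _; eexists; now apply Hdf.
  + intros z _.
    apply continuity_2d_pt_ext_loc with df.
    * destruct Hloc as [d Hd]; exists d; intros x y Hx _.
      symmetry; apply is_derive_unique, Hdf, Hd, Hx.
    * apply density_rate_continuous_2d; auto; try apply continuous_id; lra.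
  + revert Hloc; apply filter_imp; intros x [Hx HQx].
    apply ex_RInt_ring_density; intros z _; now apply Hgap.
- rewrite (RInt_ext _ (df e)).
  2:{ intros z _; apply is_derive_unique, Hdf; tauto. }
  apply is_RInt_unique.
  set (P := fun z => primitive_num r e (level_p r E e) (q e) z
               / (e * q e * sqrt (gap r e (level_p r E e) (q e) z))).
  assert (HP : minus (P (2 * PI)) (P 0) = 0).
  { unfold P, primitive_num, gap; rewrite cos_2PI, sin_2PI, cos_0, sin_0.
    apply Rminus_diag. }
  rewrite <- HP at 2.
  apply (is_RInt_derive (V := R_CompleteNormedModule)).
  + intros z _; apply density_rate_primitive, Hgap; auto.
  + intros z _; apply (continuity_2d_section (fun _ => df e) 0).
    apply (density_rate_continuous_2d r (fun _ => e) (fun _ => level_p r E e) (fun _ => q e));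
      try apply continuous_const; auto; lra.
Qed.

Lemma level_potential_continuous r th E e :
  0 < r -> noncollision r th E -> on_level r th E e ->
  continuous (level_potential r th E) e.
Proof.
intros Hr Hnc He.
assert (He0 := proj1 (proj2 He)).
apply (ring_potential_continuous r (fun e => e) (level_p r E)
         (fun e => sqrt (level_Q r th E e))).
- apply continuous_id.
- now apply continuous_level_p.
- apply (continuous_comp (level_Q r th E) sqrt).
  + now apply continuous_level_Q.
  + apply continuous_sqrt.
- intros z _; now apply level_gap_pos.
Qed.

(** The potential is continuous up to the ends of the level curve, where
    [q = sqrt level_Q] is not differentiable, and stationary between them. *)
Lemma level_potential_constant r th E e1 e2 :
  0 < r -> noncollision r th E -> on_level r th E e1 -> on_level r th E e2 ->
  level_potential r th E e1 = level_potential r th E e2.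
Proof.
intros Hr Hnc.
assert (W : forall e1 e2, on_level r th E e1 -> on_level r th E e2 -> e1 < e2 ->
  level_potential r th E e1 = level_potential r th E e2).
{ clear e1 e2; intros e1 e2 H1 H2 Hlt.
  assert (B1 := proj1 H1); assert (B2 := proj1 H2).
  assert (Hin : forall x, e1 < x < e2 -> 0 < level_Q r th E x)
    by (intros x Hx; now apply level_Q_pos_between with e1 e2).
  destruct (MVT_gen (level_potential r th E) e1 e2 (fun _ => 0)) as [x [_ Hx]];
    rewrite ?Rmin_left, ?Rmax_right by lra.
  - intros x Hx; apply level_potential_stationary; auto; lra.
  - intros x Hx; apply continuity_pt_filterlim.
    apply level_potential_continuous; auto.
    destruct (Req_dec x e1) as [-> |]; [exact H1 |].
    destruct (Req_dec x e2) as [-> |]; [exact H2 |].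
    assert (0 < level_Q r th E x) by (apply Hin; lra).
    repeat split; lra.
  - lra. }
intros H1 H2; destruct (Rtotal_order e1 e2) as [H | [-> | H]]; auto.
symmetry; auto.
Qed.

(** The point [e = sqrt (1 - E)] of the level has [cos g2 = 0]; there the
    integral of the potential is the one that defines [U]. *)
Lemma level_p_0 r E : E <= 1 -> level_p r E (sqrt (1 - E)) = 0.
Proof.
intros HE; assert (He2 : sqrt (1 - E) ^ 2 = 1 - E) by (apply pow2_sqrt; lra).
unfold level_p; replace (E - 1) with (- (sqrt (1 - E) * sqrt (1 - E))) by lra.
set (e := sqrt (1 - E)) in *.
destruct (Req_dec e 0) as [-> | He]; unfold Rdiv.
- ring.
- replace (- (e * e) * / e) with (- e) by (field; exact He); ring.
Qed.

Lemma level_Q_0 r th E : E <= 1 -> level_Q r th E (sqrt (1 - E)) = E - th ^ 2.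
Proof.
intros HE; unfold level_Q; rewrite level_p_0, pow2_sqrt by lra; ring.
Qed.

Lemma on_level_0 r th E : th ^ 2 <= E <= 1 -> on_level r th E (sqrt (1 - E)).
Proof.
intros HE; pose proof (pow2_ge_0 th).
assert (He2 : sqrt (1 - E) ^ 2 = 1 - E) by (apply pow2_sqrt; lra).
pose proof (sqrt_pos (1 - E)).
unfold on_level; rewrite level_Q_0 by lra.
repeat split; try lra; nra.
Qed.

(** * Passage to scaled variables *)

Lemma RInt_reflect (f : R -> R) : ex_RInt f 0 (2 * PI) ->
  RInt (fun z => f (2 * PI - z)) 0 (2 * PI) = RInt f 0 (2 * PI).
Proof.
intros Hf.
assert (Hf' : ex_RInt f (-1 * 0 + 2 * PI) (-1 * (2 * PI) + 2 * PI)).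
{ replace (-1 * 0 + 2 * PI) with (2 * PI) by ring.
  replace (-1 * (2 * PI) + 2 * PI) with 0 by ring.
  now apply ex_RInt_swap. }
assert (H := RInt_comp_lin (V := R_CompleteNormedModule) f (-1) (2 * PI) 0 (2 * PI) Hf').
assert (He := ex_RInt_comp_lin (V := R_NormedModule) f (-1) (2 * PI) 0 (2 * PI) Hf').
replace (-1 * 0 + 2 * PI) with (2 * PI) in H by ring.
replace (-1 * (2 * PI) + 2 * PI) with 0 in H by ring.
rewrite <- (opp_RInt_swap (V := R_CompleteNormedModule) f) in H by exact Hf.
rewrite RInt_ext with (g := fun z => opp (scal (-1) (f (-1 * z + 2 * PI)))).
- eapply eq_trans; [apply (RInt_opp (V := R_CompleteNormedModule)), He |].
  eapply eq_trans; [apply (f_equal opp); exact H | apply opp_opp].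
- intros z _; replace (2 * PI - z) with (-1 * z + 2 * PI) by ring.
  change (f (-1 * z + 2 * PI) = - (-1 * f (-1 * z + 2 * PI))); ring.
Qed.

Lemma ring_density_reflect r e p q z :
  ring_density r e p q (2 * PI - z) = ring_density r e p (- q) z.
Proof.
unfold ring_density, gap.
rewrite cos_minus, sin_minus, cos_2PI, sin_2PI.
replace (1 * cos z + 0 * sin z) with (cos z) by ring.
replace (q * (0 * cos z - 1 * sin z)) with (- q * sin z) by ring.
reflexivity.
Qed.

Lemma ring_potential_opp r e p q :
  (forall z, 0 <= z <= 2 * PI -> 0 < gap r e p q z) ->
  ring_potential r e p (- q) = ring_potential r e p q.
Proof.
intros Hg; unfold ring_potential.
rewrite <- (RInt_reflect (ring_density r e p q)) by now apply ex_RInt_ring_density.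
apply RInt_ext; intros z _; now rewrite ring_density_reflect.
Qed.

Lemma ring_potential_abs r e p q :
  (forall z, 0 <= z <= 2 * PI -> 0 < gap r e p q z) ->
  ring_potential r e p (Rabs q) = ring_potential r e p q.
Proof.
intros Hg; unfold Rabs; destruct (Rcase_abs q); [now apply ring_potential_opp | reflexivity].
Qed.

(** The points of a level curve that come from an admissible configuration: the
    ellipse is not a circle, and [e^2 + th^2 < 1] is the condition [|Th| < G2]. *)
Definition inner_level (r th E e : R) : Prop :=
  0 < e /\ e ^ 2 + th ^ 2 < 1 /\ 0 <= level_Q r th E e.

Lemma inner_level_on_level r th E e : inner_level r th E e -> on_level r th E e.
Proof.
intros (He & Ht & HQ); pose proof (pow2_ge_0 th).
assert (e < 1) by nra.
repeat split; try lra.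
Qed.

Section Scaling.

Variables m2 M2 : R.
Hypotheses (m2_gt0 : 0 < m2) (M2_gt0 : 0 < M2).

Lemma a2_gt0 L2 : 0 < L2 -> 0 < a2 m2 M2 L2.
Proof.
intros HL; unfold a2; apply Rdiv_lt_0_compat; [apply pow_lt, HL |].
apply Rmult_lt_0_compat; [apply pow_lt, m2_gt0 | exact M2_gt0].
Qed.

Lemma dist2_scaled r1 L2 Th G2 g2 zeta : 0 < L2 ->
  dist2 m2 M2 r1 L2 Th G2 g2 zeta =
  a2 m2 M2 L2 ^ 2 *
  gap (r1 / a2 m2 M2 L2) (ecc L2 G2)
    (sqrt (1 - Th ^ 2 / G2 ^ 2) * cos g2)
    (G2 / L2 * sqrt (1 - Th ^ 2 / G2 ^ 2) * sin g2) zeta.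
Proof.
intros HL; pose proof (a2_gt0 L2 HL).
unfold dist2, gap, rho2; field; lra.
Qed.

Lemma h2_scaled r1 L2 Th G2 g2 : 0 < L2 ->
  (forall zeta, 0 < dist2 m2 M2 r1 L2 Th G2 g2 zeta) ->
  h2 m2 M2 r1 L2 Th G2 g2 =
  / (2 * PI) * / a2 m2 M2 L2 *
  ring_potential (r1 / a2 m2 M2 L2) (ecc L2 G2)
    (sqrt (1 - Th ^ 2 / G2 ^ 2) * cos g2)
    (G2 / L2 * sqrt (1 - Th ^ 2 / G2 ^ 2) * sin g2).
Proof.
intros HL Hd; pose proof (a2_gt0 L2 HL) as Ha.
unfold h2, ring_potential; rewrite Rmult_assoc; f_equal.
assert (Hg : forall zeta, 0 < gap (r1 / a2 m2 M2 L2) (ecc L2 G2)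
    (sqrt (1 - Th ^ 2 / G2 ^ 2) * cos g2)
    (G2 / L2 * sqrt (1 - Th ^ 2 / G2 ^ 2) * sin g2) zeta).
{ intros zeta; specialize (Hd zeta); rewrite dist2_scaled in Hd by exact HL.
  pose proof (pow_lt _ 2 Ha); nra. }
transitivity (RInt (fun zeta => scal (/ a2 m2 M2 L2) (ring_density (r1 / a2 m2 M2 L2) (ecc L2 G2)
    (sqrt (1 - Th ^ 2 / G2 ^ 2) * cos g2)
    (G2 / L2 * sqrt (1 - Th ^ 2 / G2 ^ 2) * sin g2) zeta)) 0 (2 * PI)).
- apply RInt_ext; intros zeta _.
  rewrite dist2_scaled by exact HL.
  specialize (Hg zeta).
  rewrite sqrt_mult; [| apply pow2_ge_0 | now apply Rlt_le].
  rewrite sqrt_pow2 by now apply Rlt_le.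
  pose proof (sqrt_lt_R0 _ Hg).
  match goal with |- _ = scal ?x ?y => change (scal x y) with (x * y) end.
  match goal with |- @eq _ ?x ?y => change (@eq R x y) end.
  unfold ring_density, rho2; field; lra.
- apply (RInt_scal (V := R_CompleteNormedModule)); apply ex_RInt_ring_density; auto.
Qed.

(** An admissible configuration lies on no collision level, because such a
    level consists of collisions only. *)
Lemma admissible_inner_level r1 L2 Th G2 g2 :
  admissible m2 M2 r1 L2 Th G2 g2 ->
  let r := r1 / a2 m2 M2 L2 in
  let th := Th / L2 in
  let E := E0 m2 M2 r1 L2 Th G2 g2 / L2 ^ 2 in
  let e := ecc L2 G2 in
  0 < L2 /\ inner_level r th E e /\ noncollision r th E /\
  h2 m2 M2 r1 L2 Th G2 g2 = / (2 * PI) * / a2 m2 M2 L2 * level_potential r th E e.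
Proof.
intros (Hr1 & HTh & HGL & Hd) r th E e.
pose proof (Rabs_pos Th).
assert (HL : 0 < L2) by lra.
pose proof (a2_gt0 L2 HL) as Ha.
assert (HG : 0 < G2) by lra.
assert (HL2 : 0 < L2 ^ 2) by (apply pow_lt, HL).
assert (HG2 : 0 < G2 ^ 2) by (apply pow_lt, HG).
assert (Hr : 0 < r) by (apply Rdiv_lt_0_compat; assumption).
assert (HTG : Th ^ 2 < G2 ^ 2) by (rewrite <- (pow2_abs Th); nra).
assert (HGL2 : G2 ^ 2 < L2 ^ 2) by nra.
assert (He2 : e ^ 2 = 1 - G2 ^ 2 / L2 ^ 2).
{ unfold e, ecc; apply pow2_sqrt.
  apply Rmult_le_reg_r with (L2 ^ 2); [lra |]; field_simplify; lra. }
assert (He0 : 0 < e).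
{ apply sqrt_lt_R0; apply Rmult_lt_reg_r with (L2 ^ 2); [lra |]; field_simplify; lra. }
set (k := sqrt (1 - Th ^ 2 / G2 ^ 2)).
assert (Hk2 : k ^ 2 = 1 - Th ^ 2 / G2 ^ 2).
{ apply pow2_sqrt; apply Rmult_le_reg_r with (G2 ^ 2); [lra |]; field_simplify; lra. }
set (p := k * cos g2). set (q := G2 / L2 * k * sin g2).
assert (HE : E = 1 - e ^ 2 + r * e * p).
{ rewrite He2; unfold E, E0, r, a2; fold k; fold (ecc L2 G2); fold e; unfold p; field; lra. }
assert (Hp : level_p r E e = p) by (unfold level_p; rewrite HE; field; lra).
assert (HQ : level_Q r th E e = q ^ 2).
{ unfold level_Q; rewrite Hp, He2; unfold p, q, th.
  pose proof (sin2_cos2_pow g2) as Hsc.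
  replace ((G2 / L2 * k * sin g2) ^ 2)
    with (G2 ^ 2 / L2 ^ 2 * k ^ 2 * (sin g2 * sin g2)) by (field; lra).
  rewrite Hsc.
  replace ((k * cos g2) ^ 2) with (k ^ 2 * cos g2 ^ 2) by ring.
  rewrite Hk2; field; lra. }
assert (Hin : inner_level r th E e).
{ split; [exact He0 | split].
  - rewrite He2; unfold th; apply Rmult_lt_reg_r with (L2 ^ 2); [lra |].
    field_simplify; lra.
  - rewrite HQ; apply pow2_ge_0. }
assert (Hg : forall z, 0 < gap r e p q z).
{ intros z; specialize (Hd z); rewrite dist2_scaled in Hd by exact HL.
  fold k p e r in Hd; fold q in Hd.
  pose proof (pow_lt _ 2 Ha); nra. }
split; [exact HL |]; split; [exact Hin |]; split.
- destruct (Req_dec th 0) as [Hth | Hth]; [right | now left].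
  intros HEr.
  assert (He1 : e < 1) by (destruct Hin as (_ & ? & _); pose proof (pow2_ge_0 th); nra).
  destruct (gap_collision r e p q) as [z Hz].
  + lra.
  + rewrite <- HQ; unfold level_Q; rewrite Hp, Hth; ring.
  + rewrite <- HE; exact HEr.
  + specialize (Hg z); lra.
- rewrite h2_scaled by assumption; f_equal.
  fold k p e r; fold q; unfold level_potential.
  rewrite Hp, HQ.
  replace (q ^ 2) with (q²) by (unfold Rsqr; ring); rewrite sqrt_Rsqr_abs.
  symmetry; apply ring_potential_abs; auto.
Qed.

(** Conversely, [eta^2 p^2 + q^2 = eta^2 k^2] on the level curve, with
    [eta = G2 / L2]; so [p / k] and [q / (eta k)] are the cosine and the sine of
    an angle [g2]. *)
Lemma inner_level_admissible r1 L2 Th E e :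
  0 < r1 -> 0 < L2 ->
  let r := r1 / a2 m2 M2 L2 in
  let th := Th / L2 in
  inner_level r th (E / L2 ^ 2) e -> noncollision r th (E / L2 ^ 2) ->
  exists G2 g2, admissible m2 M2 r1 L2 Th G2 g2 /\
    E0 m2 M2 r1 L2 Th G2 g2 = E /\ ecc L2 G2 = e.
Proof.
intros Hr1 HL r th Hin Hnc.
pose proof (a2_gt0 L2 HL) as Ha.
assert (Hr : 0 < r) by (apply Rdiv_lt_0_compat; assumption).
destruct Hin as (He & Het & HQ).
assert (Hth2 := pow2_ge_0 th).
assert (He1 : e < 1) by nra.
assert (Heta2 : 0 < 1 - e ^ 2) by nra.
set (eta := sqrt (1 - e ^ 2)).
assert (Heta : 0 < eta) by (apply sqrt_lt_R0; lra).
assert (Heta' : eta ^ 2 = 1 - e ^ 2) by (apply pow2_sqrt; lra).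
assert (HTh : Th = th * L2) by (unfold th; field; lra).
set (p := level_p r (E / L2 ^ 2) e) in *.
set (q := sqrt (level_Q r th (E / L2 ^ 2) e)).
assert (Hq2 : q ^ 2 = (1 - e ^ 2) * (1 - p ^ 2) - th ^ 2) by (apply pow2_sqrt, HQ).
set (k := sqrt (1 - th ^ 2 / eta ^ 2)).
assert (Hk : 0 < 1 - th ^ 2 / eta ^ 2).
{ rewrite Heta'; apply Rmult_lt_reg_r with (1 - e ^ 2); [lra |]; field_simplify; lra. }
assert (Hk2 : k ^ 2 = 1 - th ^ 2 / eta ^ 2) by (apply pow2_sqrt; lra).
assert (Hk0 : 0 < k) by (apply sqrt_lt_R0, Hk).
destruct (angle_of_circle (p / k) (q / (eta * k))) as [g [_ [Hcg Hsg]]].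
{ replace ((p / k) ^ 2 + (q / (eta * k)) ^ 2) with ((eta ^ 2 * p ^ 2 + q ^ 2) / (eta ^ 2 * k ^ 2))
    by (field; lra).
  rewrite Hk2, Hq2, <- Heta'; field.
  split; lra. }
exists (L2 * eta), g.
assert (Hecc : ecc L2 (L2 * eta) = e).
{ unfold ecc; replace (1 - (L2 * eta) ^ 2 / L2 ^ 2) with (e ^ 2).
  - apply sqrt_pow2; lra.
  - replace ((L2 * eta) ^ 2 / L2 ^ 2) with (eta ^ 2) by (field; lra); lra. }
assert (Hkk : sqrt (1 - Th ^ 2 / (L2 * eta) ^ 2) = k).
{ unfold k; f_equal; rewrite HTh; field; lra. }
assert (HE : 1 - e ^ 2 + r * e * p = E / L2 ^ 2) by (apply level_p_energy; lra).
split; [| split; [| exact Hecc]].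
- split; [exact Hr1 |]; split; [| split].
  + apply Rsqr_incrst_0; try apply Rabs_pos; [| nra].
    rewrite <- Rsqr_abs, HTh; unfold Rsqr.
    assert (th ^ 2 < eta ^ 2) by lra.
    assert (0 < L2 ^ 2) by (apply pow_lt, HL). nra.
  + assert (eta < 1) by nra. nra.
  + intros zeta; rewrite dist2_scaled by exact HL.
    fold r; rewrite Hkk, Hecc, Hcg, Hsg.
    replace (k * (p / k)) with p by (field; lra).
    replace (L2 * eta / L2 * k * (q / (eta * k))) with q by (field; lra).
    apply Rmult_lt_0_compat; [apply pow_lt, Ha |].
    apply (gap_pos r th); [exact Hr | lra | exact Hq2 | rewrite HE; exact Hnc].
- unfold E0; rewrite Hkk; fold (ecc L2 (L2 * eta)); rewrite Hecc, Hcg.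
  transitivity (L2 ^ 2 * (1 - e ^ 2 + r * e * p)).
  + rewrite <- Heta'; unfold r, a2; field; lra.
  + rewrite HE; field; lra.
Qed.

End Scaling.

(** * Power series of an inverse square root *)

Lemma CV_radius_geometric (a : nat -> R) M K x : 0 < K ->
  (forall n, Rabs (a n) <= M * K ^ n) -> Rabs x * K < 1 ->
  Rbar_lt (Rabs x) (CV_radius a).
Proof.
intros HK Ha Hx.
apply Rbar_lt_le_trans with (/ K).
- simpl; apply Rmult_lt_reg_r with K; [exact HK |]; rewrite Rinv_l; lra.
- apply (proj1 (CV_radius_bounded a)); exists M; intros n.
  rewrite Rabs_mult, pow_inv, (Rabs_pos_eq (/ K ^ n)).
  2:{ apply Rlt_le, Rinv_0_lt_compat, pow_lt, HK. }
  pose proof (pow_lt _ n HK).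
  apply Rmult_le_reg_r with (K ^ n); [assumption |].
  rewrite Rmult_assoc, Rinv_l by lra; rewrite Rmult_1_r; apply Ha.
Qed.

(** The terms after the first add up to less than [t / (1 - t) < 1], where
    [t = K |x| < 1 / 2]. *)
Lemma PSeries_pos (a : nat -> R) K x : 0 < K -> a O = 1 ->
  (forall n, Rabs (a n) <= K ^ n) -> Rabs x * (2 * K) < 1 -> 0 < PSeries a x.
Proof.
intros HK Ha0 Ha Hx.
assert (Hcv : Rbar_lt (Rabs x) (CV_radius a)).
{ apply CV_radius_geometric with 1 K; auto; [intros n; rewrite Rmult_1_l; auto |].
  pose proof (Rabs_pos x); nra. }
rewrite PSeries_decr_1 by now apply CV_radius_inside.
rewrite Ha0; unfold PSeries.
set (t := Rabs x * K).
assert (Ht : 0 <= t < 1 / 2).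
{ unfold t; pose proof (Rabs_pos x); split; [apply Rmult_le_pos; lra | lra]. }
rewrite <- Series_scal_l.
set (u := fun n => x * (PS_decr_1 a n * x ^ n)).
assert (Hu : forall n, 0 <= Rabs (u n) <= t * t ^ n).
{ intros n; split; [apply Rabs_pos |].
  unfold u, PS_decr_1; replace (x * (a (S n) * x ^ n)) with (a (S n) * x ^ S n) by (simpl; ring).
  rewrite Rabs_mult, <- RPow_abs; unfold t.
  change (Rabs x * K * (Rabs x * K) ^ n) with ((Rabs x * K) ^ S n).
  rewrite Rpow_mult_distr, Rmult_comm.
  apply Rmult_le_compat_l; [apply pow_le, Rabs_pos | apply Ha]. }
assert (Hg : is_series (fun n => t * t ^ n) (t * / (1 - t))).
{ apply (is_series_scal_l (K := R_AbsRing) t (fun n => t ^ n)), is_series_geom.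
  rewrite Rabs_pos_eq; lra. }
assert (Hexg : ex_series (fun n => t * t ^ n)) by (eexists; exact Hg).
assert (Hex : ex_series (fun n => Rabs (u n))).
{ apply (ex_series_le (V := R_CompleteNormedModule) (fun n => Rabs (u n)) (fun n => t * t ^ n)); [| exact Hexg].
  intros n; change (Rabs (Rabs (u n)) <= t * t ^ n); rewrite Rabs_Rabsolu; apply Hu. }
assert (B : Rabs (Series u) < 1).
{ apply Rle_lt_trans with (1 := Series_Rabs u Hex).
  apply Rle_lt_trans with (1 := Series_le _ _ Hu Hexg).
  rewrite (is_series_unique _ _ Hg).
  apply Rmult_lt_reg_r with (1 - t); [lra |].
  rewrite Rmult_assoc, Rinv_l; lra. }
apply Rabs_def2 in B; lra.
Qed.

Lemma sum_geometric_half (K : R) n :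
  sum_f_R0 (fun k => K ^ S k * (2 * K) ^ (n - k)) n <= (2 * K) ^ S n * (1 - (1 / 2) ^ S n).
Proof.
rewrite (sum_eq _ (fun k => (1 / 2) ^ k * (1 / 2 * (2 * K) ^ S n))).
- rewrite <- (scal_sum (fun k => (1 / 2) ^ k)), tech3 by lra.
  apply Req_le; field.
- intros k Hk.
  replace (S n) with (S k + (n - k))%nat by lia.
  rewrite pow_add, (Rpow_mult_distr 2 K (S k)).
  rewrite <- Rmult_assoc, (Rmult_comm ((1 / 2) ^ k)).
  change (1 / 2 * (1 / 2) ^ k) with ((1 / 2) ^ S k).
  replace ((1 / 2) ^ S k) with (/ 2 ^ S k).
  + field. apply pow_nonzero; lra.
  + replace (1 / 2) with (/ 2) by field. now rewrite pow_inv.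
Qed.

(** Comparing coefficients in [2 f g' + f' g = 0], the differential equation of
    [g = 1 / sqrt f], gives a recursion for the coefficients [b] of [g] in terms
    of the coefficients [a] of [f].  No weight in it exceeds the factor on its
    left-hand side, so that geometric bounds propagate. *)
Section Rsqrt_series.

Variables (a b : nat -> R) (K : R).
Hypotheses (K_gt0 : 0 < K) (a_0 : a O = 1) (b_0 : b O = 1).
Hypothesis a_bound : forall n, Rabs (a n) <= K ^ n.
Hypothesis b_rec : forall n, INR (S n) * b (S n) =
  - sum_f_R0 (fun k => (INR (n - k) + INR (S k) / 2) * a (S k) * b (n - k)%nat) n.

Lemma rsqrt_coef_bound n : Rabs (b n) <= (2 * K) ^ n.
Proof.
induction n as [n IH] using (well_founded_induction Wf_nat.lt_wf).
destruct n as [| n]; [rewrite b_0, Rabs_R1; simpl; lra |].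
assert (HS : 0 < INR (S n)) by (apply lt_0_INR; lia).
apply Rmult_le_reg_l with (INR (S n)); [exact HS |].
rewrite <- (Rabs_pos_eq (INR (S n))) at 1 by lra.
rewrite <- Rabs_mult, b_rec, Rabs_Ropp.
eapply Rle_trans; [apply Rsum_abs |].
apply Rle_trans with (INR (S n) * sum_f_R0 (fun k => K ^ S k * (2 * K) ^ (n - k)) n).
- rewrite scal_sum; apply sum_Rle; intros k Hk.
  rewrite !Rabs_mult.
  assert (Hc : Rabs (INR (n - k) + INR (S k) / 2) <= INR (S n)).
  { pose proof (pos_INR (n - k)); pose proof (pos_INR (S k)).
    rewrite Rabs_pos_eq by lra.
    replace (S n) with ((n - k) + S k)%nat by lia; rewrite plus_INR; lra. }
  rewrite Rmult_comm, (Rmult_comm (K ^ S k)).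
  rewrite (Rmult_comm _ (Rabs (a (S k)))), <- Rmult_assoc.
  apply Rmult_le_compat; try apply Rabs_pos; [| | exact Hc].
  + apply Rmult_le_pos; apply Rabs_pos.
  + apply Rmult_le_compat; try apply Rabs_pos; [apply IH; lia | apply a_bound].
- apply Rmult_le_compat_l; [lra |].
  eapply Rle_trans; [apply sum_geometric_half |].
  assert (0 < (2 * K) ^ S n) by (apply pow_lt; lra).
  assert (0 < (1 / 2) ^ S n) by (apply pow_lt; lra).
  nra.
Qed.

Lemma rsqrt_coef_ode n :
  PS_mult a (PS_derive b) n + / 2 * PS_mult (PS_derive a) b n = 0.
Proof.
assert (H1 : PS_mult a (PS_derive b) n =
  INR (S n) * b (S n) + sum_f_R0 (fun k => a (S k) * (INR (n - k) * b (n - k)%nat)) n).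
{ transitivity (sum_f_R0 (fun k => a k * (INR (S n - k) * b (S n - k)%nat)) (S n)).
  - rewrite tech5, Nat.sub_diag; simpl (INR 0); rewrite Rmult_0_l, Rmult_0_r, Rplus_0_r.
    apply sum_eq; intros k Hk; unfold PS_derive.
    now replace (S n - k)%nat with (S (n - k)) by lia.
  - rewrite decomp_sum by lia.
    rewrite a_0, Rmult_1_l, Nat.sub_0_r; reflexivity. }
rewrite H1, b_rec.
unfold PS_mult, PS_derive.
rewrite scal_sum.
rewrite Rplus_assoc, <- sum_plus.
rewrite Rplus_comm.
match goal with |- ?x + - ?y = 0 => assert (E : x = y) end.
{ apply sum_eq; intros k _; field. }
rewrite E; ring.
Qed.

(** By the differential equation [g^2 f] is constant.  The radius is chosen so
    small that both series are positive, which fixes the sign of the root. *)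
Lemma rsqrt_pseries x : Rabs x * (4 * K) < 1 ->
  is_pseries b x (/ sqrt (PSeries a x)).
Proof.
intros Hx.
assert (Hcv : forall y, Rabs y <= Rabs x ->
  Rbar_lt (Rabs y) (CV_radius a) /\ Rbar_lt (Rabs y) (CV_radius b)).
{ intros y Hy; pose proof (Rabs_pos y); split.
  - apply CV_radius_geometric with 1 K; auto; [intros n; rewrite Rmult_1_l; auto | nra].
  - apply CV_radius_geometric with 1 (2 * K); [lra | | nra].
    intros n; rewrite Rmult_1_l; apply rsqrt_coef_bound. }
assert (Hder : forall y, Rabs y <= Rabs x ->
  is_derive (fun y => PSeries b y ^ 2 * PSeries a y) y 0).
{ intros y Hy; destruct (Hcv y Hy) as [Ca Cb].
  pose proof (is_derive_PSeries a y Ca) as Da.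
  pose proof (is_derive_PSeries b y Cb) as Db.
  assert (Ode : PSeries a y * PSeries (PS_derive b) y
     + / 2 * (PSeries (PS_derive a) y * PSeries b y) = 0).
  { rewrite <- !PSeries_mult; rewrite ?CV_radius_derive; auto.
    rewrite <- PSeries_scal, <- PSeries_plus.
    - rewrite (PSeries_ext _ (fun _ => 0)).
      + apply PSeries_const_0.
      + intros n; apply rsqrt_coef_ode.
    - apply ex_pseries_mult; rewrite ?CV_radius_derive; auto.
    - apply ex_pseries_scal; [apply Rmult_comm |].
      apply ex_pseries_mult; rewrite ?CV_radius_derive; auto. }
  auto_derive.
  - repeat split; eexists; eassumption.
  - rewrite (is_derive_unique (fun y : R => PSeries a y) _ _ Da),
      (is_derive_unique (fun y : R => PSeries b y) _ _ Db).
    transitivity (2 * PSeries b y * (PSeries a y * PSeries (PS_derive b) y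
     + / 2 * (PSeries (PS_derive a) y * PSeries b y))); [field | rewrite Ode; ring]. }
assert (Hone : PSeries b x ^ 2 * PSeries a x = 1).
{ destruct (MVT_gen (fun y => PSeries b y ^ 2 * PSeries a y) 0 x (fun _ => 0)) as [y [_ Hy]].
  - intros y Hy; apply Hder.
    revert Hy; unfold Rmin, Rmax, Rabs; destruct (Rle_dec 0 x), (Rcase_abs y), (Rcase_abs x); lra.
  - intros y Hy; apply continuity_pt_filterlim.
    apply (ex_derive_continuous (K := R_AbsRing) (V := R_NormedModule) (fun y => PSeries b y ^ 2 * PSeries a y) y).
    exists 0; apply Hder.
    revert Hy; unfold Rmin, Rmax, Rabs; destruct (Rle_dec 0 x), (Rcase_abs y), (Rcase_abs x); lra.
  - rewrite !PSeries_0, a_0, b_0 in Hy; lra. }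
assert (Pa : 0 < PSeries a x).
{ apply PSeries_pos with K; auto; pose proof (Rabs_pos x); nra. }
assert (Pb : 0 < PSeries b x).
{ apply PSeries_pos with (2 * K); auto; try lra. apply rsqrt_coef_bound. }
replace (/ sqrt (PSeries a x)) with (PSeries b x).
- apply PSeries_correct, CV_radius_inside, Hcv; lra.
- pose proof (sqrt_lt_R0 _ Pa).
  apply Rmult_eq_reg_r with (sqrt (PSeries a x)); [| lra].
  rewrite Rinv_l by lra.
  pose proof (sqrt_sqrt (PSeries a x) (Rlt_le _ _ Pa)).
  assert ((PSeries b x * sqrt (PSeries a x)) ^ 2 = 1).
  { rewrite <- Hone; transitivity (PSeries b x ^ 2 * (sqrt (PSeries a x) * sqrt (PSeries a x))).
    - ring.
    - now rewrite H0. }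
  assert (0 < PSeries b x * sqrt (PSeries a x)) by now apply Rmult_lt_0_compat.
  nra.
Qed.

End Rsqrt_series.

(** * Power series with uniform bounds *)

Lemma continuous_sum_f_R0 (f : nat -> R -> R) z n :
  (forall k, (k <= n)%nat -> continuous (f k) z) ->
  continuous (fun z => sum_f_R0 (fun k => f k z) n) z.
Proof.
induction n as [| n IH]; intros Hf; simpl.
- apply Hf; lia.
- apply (continuous_plus (V := R_NormedModule)); [apply IH; intros; apply Hf; lia | apply Hf; lia].
Qed.

(** The recursion refers to all earlier coefficients; [rsqrt_table a n] tabulates
    those of index at most [n]. *)
Fixpoint rsqrt_table (a : nat -> R) (n : nat) : nat -> R :=
  match n with
  | O => fun _ => 1
  | S m => fun i =>
      if (i <=? m)%nat then rsqrt_table a m i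
      else - / INR (S m) * sum_f_R0 (fun k =>
        (INR (m - k) + INR (S k) / 2) * a (S k) * rsqrt_table a m (m - k)%nat) m
  end.

Definition rsqrt_coef (a : nat -> R) (n : nat) : R := rsqrt_table a n n.

Lemma rsqrt_table_stable a i n : (i <= n)%nat -> rsqrt_table a n i = rsqrt_coef a i.
Proof.
induction 1 as [| n Hi IH]; [reflexivity |].
simpl; now rewrite (proj2 (Nat.leb_le i n) Hi).
Qed.

Lemma rsqrt_coef_S a n : rsqrt_coef a (S n) =
  - / INR (S n) * sum_f_R0 (fun k =>
    (INR (n - k) + INR (S k) / 2) * a (S k) * rsqrt_coef a (n - k)%nat) n.
Proof.
unfold rsqrt_coef at 1; cbn [rsqrt_table].
rewrite (proj2 (Nat.leb_gt (S n) n)) by lia.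
f_equal; apply sum_eq; intros k Hk; now rewrite rsqrt_table_stable by lia.
Qed.

Lemma rsqrt_coef_rec a n : INR (S n) * rsqrt_coef a (S n) =
  - sum_f_R0 (fun k => (INR (n - k) + INR (S k) / 2) * a (S k) * rsqrt_coef a (n - k)%nat) n.
Proof.
rewrite rsqrt_coef_S; field; apply not_0_INR; lia.
Qed.

Lemma rsqrt_coef_continuous (a : nat -> R -> R) z n :
  (forall k, continuous (a k) z) ->
  continuous (fun z => rsqrt_coef (fun k => a k z) n) z.
Proof.
intros Ha; induction n as [n IH] using (well_founded_induction lt_wf).
destruct n as [| n]; [apply continuous_const |].
eapply continuous_ext; [intros y; symmetry; apply rsqrt_coef_S |].
apply (continuous_mult (K := R_AbsRing)); [apply continuous_const |].
apply continuous_sum_f_R0; intros k Hk.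
apply (continuous_mult (K := R_AbsRing)); [| apply IH; lia].
apply (continuous_mult (K := R_AbsRing)); [apply continuous_const | apply Ha].
Qed.

(** Functions analytic in [x] near [0], with coefficients depending
    continuously on a parameter [z] and bounded by a geometric sequence
    independent of [z].  This class is closed under the operations that form the
    density, and the bounds allow termwise integration over [z]. *)
Definition uniform_pseries (f : R -> R -> R) : Prop :=
  exists (c : nat -> R -> R) (M K : R), 0 < K /\
    (forall n z, continuous (c n) z) /\
    (forall n z, Rabs (c n z) <= M * K ^ n) /\
    (forall x z, Rabs x * K < 1 -> is_pseries (fun n => c n z) x (f x z)).

Lemma geometric_bound_weaken (u : nat -> R) M K M' K' :
  0 < K -> M <= M' -> K <= K' ->
  (forall n, Rabs (u n) <= M * K ^ n) -> forall n, Rabs (u n) <= M' * K' ^ n.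
Proof.
intros HK HM HK' Hu n.
assert (0 <= M).
{ generalize (Hu O); simpl; pose proof (Rabs_pos (u O)); lra. }
eapply Rle_trans; [apply Hu |].
apply Rmult_le_compat; auto.
- apply pow_le; lra.
- apply pow_incr; lra.
Qed.

Lemma uniform_pseries_common f g :
  uniform_pseries f -> uniform_pseries g ->
  exists (c d : nat -> R -> R) (M K : R), 0 <= M /\ 0 < K /\
    (forall n z, continuous (c n) z) /\ (forall n z, continuous (d n) z) /\
    (forall n z, Rabs (c n z) <= M * K ^ n) /\
    (forall n z, Rabs (d n z) <= M * K ^ n) /\
    (forall x z, Rabs x * K < 1 ->
       is_pseries (fun n => c n z) x (f x z) /\ is_pseries (fun n => d n z) x (g x z)).
Proof.
intros (c & M & K & HK & Cc & Bc & Sc) (d & N & L & HL & Cd & Bd & Sd).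
exists c, d, (Rmax M N), (Rmax K L).
pose proof (Rmax_l M N); pose proof (Rmax_r M N).
pose proof (Rmax_l K L); pose proof (Rmax_r K L).
assert (0 <= M).
{ generalize (Bc O 0); simpl; pose proof (Rabs_pos (c O 0)); lra. }
repeat split; auto; try lra.
- intros n z; apply (geometric_bound_weaken (fun n => c n z) M K); auto.
- intros n z; apply (geometric_bound_weaken (fun n => d n z) N L); auto.
- apply Sc; pose proof (Rabs_pos x); nra.
- apply Sd; pose proof (Rabs_pos x); nra.
Qed.

Lemma uniform_pseries_plus f g :
  uniform_pseries f -> uniform_pseries g ->
  uniform_pseries (fun x z => f x z + g x z).
Proof.
intros Hf Hg.
destruct (uniform_pseries_common f g Hf Hg) as (c & d & M & K & HM & HK & Cc & Cd & Bc & Bd & Hs).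
exists (fun n z => c n z + d n z), (2 * M), K; repeat split; auto.
- intros n z; apply (continuous_plus (V := R_NormedModule)); auto.
- intros n z; eapply Rle_trans; [apply Rabs_triang |].
  specialize (Bc n z); specialize (Bd n z); lra.
- intros x z Hx; destruct (Hs x z Hx) as [S1 S2].
  apply (is_pseries_plus _ _ _ _ _ S1 S2).
Qed.

Lemma uniform_pseries_mult f g :
  uniform_pseries f -> uniform_pseries g ->
  uniform_pseries (fun x z => f x z * g x z).
Proof.
intros Hf Hg.
destruct (uniform_pseries_common f g Hf Hg) as (c & d & M & K & HM & HK & Cc & Cd & Bc & Bd & Hs).
exists (fun n z => PS_mult (fun n => c n z) (fun n => d n z) n), (M * M), (2 * K); repeat split.
- lra.
- intros n z; apply continuous_sum_f_R0; intros k _.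
  apply (continuous_mult (K := R_AbsRing)); auto.
- intros n z; unfold PS_mult.
  eapply Rle_trans; [apply Rsum_abs |].
  apply Rle_trans with (sum_f_R0 (fun _ => M * M * K ^ n) n).
  + apply sum_Rle; intros k Hk.
    rewrite Rabs_mult.
    replace (M * M * K ^ n) with ((M * K ^ k) * (M * K ^ (n - k))).
    * apply Rmult_le_compat; auto; apply Rabs_pos.
    * replace n with (k + (n - k))%nat at 2 by lia; rewrite pow_add; ring.
  + rewrite sum_cte, Rpow_mult_distr, <- Rmult_assoc.
    rewrite (Rmult_assoc (M * M)), (Rmult_comm (K ^ n)), <- Rmult_assoc.
    apply Rmult_le_compat_r; [apply pow_le; lra |].
    apply Rmult_le_compat_l; [apply Rmult_le_pos; exact HM |].
    clear; induction n as [| n IH]; [simpl; lra |].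
    rewrite S_INR; simpl pow.
    assert (1 <= 2 ^ n) by (apply pow_R1_Rle; lra); lra.
- intros x z Hx.
  assert (Hx' : Rabs x * K < 1) by (pose proof (Rabs_pos x); nra).
  destruct (Hs x z Hx') as [S1 S2].
  apply is_pseries_mult; auto; apply CV_radius_geometric with M K; auto.
Qed.

Lemma uniform_pseries_ext f g :
  (forall x z, f x z = g x z) -> uniform_pseries f -> uniform_pseries g.
Proof.
intros Hfg (c & M & K & HK & Cc & Bc & Sc).
exists c, M, K; repeat split; auto.
intros x z Hx; rewrite <- Hfg; now apply Sc.
Qed.

Lemma is_pseries_affine (a b x : R) :
  is_pseries (fun n => match n with 0%nat => a | 1%nat => b | _ => 0 end) x (a + b * x).
Proof.
apply is_series_Reals; intros eps Heps; exists 1%nat; intros n Hn.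
replace (sum_f_R0 _ n) with (a + b * x).
- unfold Rdist; rewrite Rminus_diag, Rabs_R0; exact Heps.
- induction Hn as [| n Hn IH].
  + simpl; unfold scal, mult, one; simpl; unfold mult, one; simpl; ring.
  + rewrite tech5, <- IH.
    destruct n as [| n]; [lia |].
    change (scal ?u 0) with (u * 0); ring.
Qed.

Lemma uniform_pseries_fun (g : R -> R) M :
  (forall z, continuous g z) -> (forall z, Rabs (g z) <= M) ->
  uniform_pseries (fun _ z => g z).
Proof.
intros Cg Bg.
exists (fun n z => match n with 0%nat => g z | 1%nat => 0 | _ => 0 end), M, 1.
repeat split.
- lra.
- intros [| [| n]] z; auto; apply continuous_const.
- intros n z; rewrite pow1, Rmult_1_r; specialize (Bg z).
  pose proof (Rabs_pos (g z)).
  destruct n as [| [| n]]; rewrite ?Rabs_R0; lra.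
- intros x z _; generalize (is_pseries_affine (g z) 0 x).
  now rewrite Rmult_0_l, Rplus_0_r.
Qed.

Lemma uniform_pseries_const (k : R) : uniform_pseries (fun _ _ => k).
Proof.
apply (uniform_pseries_fun (fun _ => k) (Rabs k)); intros z; [apply continuous_const | lra].
Qed.

Lemma uniform_pseries_id : uniform_pseries (fun x _ => x).
Proof.
exists (fun n _ => match n with 0%nat => 0 | 1%nat => 1 | _ => 0 end), 1, 1.
repeat split.
- lra.
- intros [| [| n]] z; apply continuous_const.
- intros n z; rewrite pow1, Rmult_1_r.
  destruct n as [| [| n]]; rewrite ?Rabs_R0, ?Rabs_R1; lra.
- intros x z _; generalize (is_pseries_affine 0 1 x).
  now rewrite Rmult_1_l, Rplus_0_l.
Qed.

Lemma uniform_pseries_at_0 c (f : R -> R -> R) (z : R) :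
  is_pseries (fun n => c n z) 0 (f 0 z) -> c O z = f 0 z.
Proof.
intros H; apply is_pseries_unique in H; rewrite PSeries_0 in H; exact H.
Qed.

(** Dividing by the coefficient of order [0], which is bounded below by [m],
    reduces the claim to series with constant term [1]. *)
Lemma uniform_pseries_rsqrt f m : 0 < m -> (forall z, m <= f 0 z) ->
  uniform_pseries f -> uniform_pseries (fun x z => / sqrt (f x z)).
Proof.
intros Hm Hf (c & M & K & HK & Cc & Bc & Sc).
assert (HM : 0 <= M).
{ generalize (Bc O 0); simpl; pose proof (Rabs_pos (c O 0)); lra. }
assert (H0 : forall z, m <= c O z).
{ intros z; rewrite (uniform_pseries_at_0 c f); [apply Hf |].
  apply Sc; rewrite Rabs_R0; lra. }
set (a := fun n z => c n z / c O z).
set (L := K * (1 + M / m)).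
assert (HMm : 0 <= M / m) by (apply Rmult_le_pos; [exact HM | apply Rlt_le, Rinv_0_lt_compat, Hm]).
assert (HL : 0 < L) by (unfold L; apply Rmult_lt_0_compat; lra).
assert (HKL : K <= L) by (unfold L; nra).
assert (a0 : forall z, a O z = 1) by (intros z; unfold a; field; specialize (H0 z); lra).
assert (Ba : forall n z, Rabs (a n z) <= L ^ n).
{ intros [| n] z; [rewrite a0, Rabs_R1; simpl; lra |].
  unfold a, Rdiv; rewrite Rabs_mult, Rabs_inv.
  specialize (H0 z).
  rewrite (Rabs_pos_eq (c O z)) by lra.
  apply Rle_trans with ((M * K ^ S n) * / m).
  - apply Rmult_le_compat; auto; [apply Rabs_pos | |].
    + apply Rlt_le, Rinv_0_lt_compat; lra.
    + apply Rinv_le_contravar; lra.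
  - unfold L; rewrite Rpow_mult_distr.
    replace (M * K ^ S n * / m) with (K ^ S n * (M / m)) by (unfold Rdiv; ring).
    apply Rmult_le_compat_l; [apply pow_le; lra |].
    assert (1 <= (1 + M / m) ^ n) by (apply pow_R1_Rle; lra).
    simpl; nra. }
exists (fun n z => rsqrt_coef (fun k => a k z) n * / sqrt (c O z)), (/ sqrt m), (4 * L).
assert (Hsm := sqrt_lt_R0 m Hm).
repeat split.
- lra.
- intros n z; specialize (H0 z).
  apply (continuous_mult (K := R_AbsRing)).
  + apply rsqrt_coef_continuous; intros k.
    apply (continuous_mult (K := R_AbsRing)); [apply Cc |].
    apply continuous_Rinv_comp; [apply Cc | lra].
  + apply continuous_Rinv_comp.
    * apply (continuous_comp (c O) sqrt); [apply Cc | apply continuous_sqrt].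
    * apply Rgt_not_eq, sqrt_lt_R0; lra.
- intros n z; specialize (H0 z); rewrite Rabs_mult, Rabs_inv.
  assert (Hs := sqrt_le_1_alt _ _ H0).
  rewrite (Rabs_pos_eq (sqrt (c O z))) by lra.
  rewrite Rmult_comm; apply Rmult_le_compat; try apply Rabs_pos.
  + apply Rlt_le, Rinv_0_lt_compat; lra.
  + apply Rinv_le_contravar; lra.
  + eapply Rle_trans.
    * apply (rsqrt_coef_bound (fun k => a k z) _ L); auto. apply rsqrt_coef_rec.
    * apply pow_incr; lra.
- intros x z Hx; specialize (H0 z).
  assert (HxL : Rabs x * (4 * L) < 1) by exact Hx.
  assert (HxK : Rabs x * K < 1) by (pose proof (Rabs_pos x); nra).
  pose proof (rsqrt_pseries (fun k => a k z) (rsqrt_coef (fun k => a k z)) L HL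
    (a0 z) eq_refl (fun n => Ba n z) (rsqrt_coef_rec _) x HxL) as Hb.
  assert (Ha : PSeries (fun k => a k z) x = f x z / c O z).
  { rewrite (PSeries_ext _ (PS_scal (/ c O z) (fun k => c k z))).
    - rewrite PSeries_scal, (is_pseries_unique _ _ _ (Sc x z HxK)); unfold Rdiv; ring.
    - intros k; unfold a, PS_scal, Rdiv; apply Rmult_comm. }
  assert (Pa : 0 < PSeries (fun k => a k z) x).
  { apply PSeries_pos with L; auto; pose proof (Rabs_pos x); nra. }
  assert (Hfx : 0 < f x z).
  { replace (f x z) with (PSeries (fun k => a k z) x * c O z) by (rewrite Ha; field; lra).
    apply Rmult_lt_0_compat; lra. }
  replace (/ sqrt (f x z)) with (scal (/ sqrt (c O z)) (/ sqrt (PSeries (fun k => a k z) x))).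
  + eapply is_pseries_ext; [| apply (is_pseries_scal (/ sqrt (c O z)) _ x _ (Rmult_comm _ _) Hb)].
    intros n; apply Rmult_comm.
  + change (/ sqrt (c O z) * / sqrt (PSeries (fun k => a k z) x) = / sqrt (f x z)).
    rewrite Ha, sqrt_div by lra.
    pose proof (sqrt_lt_R0 _ Hfx).
    assert (0 < sqrt (c O z)) by (apply sqrt_lt_R0; lra).
    field; lra.
Qed.

Lemma geometric_tail (u : nat -> R) l M t N : 0 <= t < 1 ->
  (forall n, Rabs (u n) <= M * t ^ n) -> is_series u l ->
  Rabs (l - sum_n u N) <= M * t ^ S N / (1 - t).
Proof.
intros Ht Hu Hl.
assert (HM : 0 <= M).
{ generalize (Hu O); simpl; pose proof (Rabs_pos (u O)); lra. }
assert (HP : forall j, Rabs (sum_n u (N + j) - sum_n u N)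
     <= M * (t ^ S N - t ^ S (N + j)) / (1 - t)).
{ induction j as [| j IH].
  - rewrite Nat.add_0_r, !Rminus_diag, Rabs_R0, Rmult_0_r; unfold Rdiv; lra.
  - rewrite Nat.add_succ_r, sum_Sn.
    change (plus (sum_n u (N + j)) (u (S (N + j)))) with (sum_n u (N + j) + u (S (N + j))).
    replace (sum_n u (N + j) + u (S (N + j)) - sum_n u N)
      with ((sum_n u (N + j) - sum_n u N) + u (S (N + j))) by ring.
    eapply Rle_trans; [apply Rabs_triang |].
    specialize (Hu (S (N + j))).
    replace (M * (t ^ S N - t ^ S (S (N + j))) / (1 - t))
      with (M * (t ^ S N - t ^ S (N + j)) / (1 - t) + M * t ^ S (N + j)).
    + lra.
    + simpl; field; lra. }
assert (L1 : is_lim_seq (fun j => Rabs (sum_n u (N + j) - sum_n u N)) (Rabs (l - sum_n u N))).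
{ apply (is_lim_seq_abs (fun j => sum_n u (N + j) - sum_n u N) (l - sum_n u N)).
  apply is_lim_seq_minus'; [| apply is_lim_seq_const].
  apply is_lim_seq_ext with (fun j => sum_n u (j + N)); [intros; now rewrite Nat.add_comm |].
  apply -> is_lim_seq_incr_n; exact Hl. }
refine (is_lim_seq_le _ _ _ _ _ L1 (is_lim_seq_const (M * t ^ S N / (1 - t)))).
intros j; eapply Rle_trans; [apply HP |].
apply Rmult_le_compat_r; [apply Rlt_le, Rinv_0_lt_compat; lra |].
apply Rmult_le_compat_l; [exact HM |].
assert (0 <= t ^ S (N + j)) by (apply pow_le; lra); lra.
Qed.

Lemma is_RInt_sum_n (f : nat -> R -> R) (a b : R) n :
  (forall k, ex_RInt (f k) a b) ->
  is_RInt (fun z => sum_n (fun k => f k z) n) a b (sum_n (fun k => RInt (f k) a b) n).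
Proof.
intros Hf; induction n as [| n IH].
- apply (is_RInt_ext (f O)); [intros z _; symmetry; apply sum_O |].
  rewrite sum_O; apply (RInt_correct (V := R_CompleteNormedModule)), Hf.
- apply (is_RInt_ext (fun z => plus (sum_n (fun k => f k z) n) (f (S n) z))).
  { intros z _; symmetry; apply sum_Sn. }
  rewrite sum_Sn; apply (is_RInt_plus (V := R_NormedModule)); [exact IH |].
  apply (RInt_correct (V := R_CompleteNormedModule)), Hf.
Qed.

(** The partial sums converge uniformly in [z], by the geometric tail bound. *)
Lemma uniform_pseries_RInt f a b : uniform_pseries f ->
  exists (c : nat -> R) (rad : R), 0 < rad /\
    forall x, Rabs x < rad -> is_pseries c x (RInt (f x) a b).
Proof.
intros (c & M & K & HK & Cc & Bc & Sc).
exists (fun n => RInt (c n) a b), (/ K); split; [apply Rinv_0_lt_compat, HK |].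
intros x Hx.
assert (HxK : Rabs x * K < 1).
{ apply Rmult_lt_compat_r with (r := K) in Hx; [rewrite Rinv_l in Hx |]; lra. }
set (t := Rabs x * K) in *.
assert (Ht : 0 <= t < 1) by (split; [apply Rmult_le_pos; [apply Rabs_pos | lra] | exact HxK]).
assert (Hex : forall n, ex_RInt (c n) a b).
{ intros n; apply (ex_RInt_continuous (V := R_CompleteNormedModule)); auto. }
set (u := fun n z => scal (pow_n x n) (c n z)).
assert (Hexu : forall n, ex_RInt (u n) a b).
{ intros n; apply (ex_RInt_scal (V := R_NormedModule)), Hex. }
assert (Hu : forall n z, Rabs (u n z) <= M * t ^ n).
{ intros n z; unfold u; change (scal (pow_n x n) (c n z)) with (pow_n x n * c n z).
  rewrite pow_n_pow, Rabs_mult, <- RPow_abs; unfold t; rewrite Rpow_mult_distr.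
  replace (M * (Rabs x ^ n * K ^ n)) with (Rabs x ^ n * (M * K ^ n)) by ring.
  apply Rmult_le_compat_l; [apply pow_le, Rabs_pos | apply Bc]. }
destruct (filterlim_RInt (V := R_CompleteNormedModule)
   (fun N z => sum_n (fun k => u k z) N) a b eventually _ (f x)
   (fun N => sum_n (fun k => RInt (u k) a b) N)) as [I [HI1 HI2]].
- intros N; now apply is_RInt_sum_n.
- apply (filterlim_locally (U := fct_UniformSpace R R_UniformSpace)); intros eps.
  assert (Hlim : is_lim_seq (fun N => M / (1 - t) * t ^ S N) 0).
  { replace (Finite 0) with (Rbar_mult (M / (1 - t)) 0) by (simpl; f_equal; ring).
    apply is_lim_seq_scal_l, (is_lim_seq_incr_1 (fun N => t ^ N)), is_lim_seq_geom.
    rewrite Rabs_pos_eq; lra. }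
  apply is_lim_seq_spec in Hlim; generalize (Hlim eps); apply filter_imp.
  intros N HN z.
  change (Rabs (sum_n (fun k => u k z) N - f x z) < eps).
  rewrite Rabs_minus_sym.
  apply Rle_lt_trans with (M * t ^ S N / (1 - t)).
  + apply geometric_tail; auto. apply Sc, HxK.
  + rewrite Rminus_0_r in HN.
    replace (M * t ^ S N / (1 - t)) with (M / (1 - t) * t ^ S N) by (unfold Rdiv; ring).
    eapply Rle_lt_trans; [apply Rle_abs | exact HN].
- rewrite (is_RInt_unique (V := R_CompleteNormedModule) _ _ _ _ HI2).
  refine (filterlim_ext _ _ _ HI1); intros N.
  apply sum_n_ext; intros k.
  apply (RInt_scal (V := R_CompleteNormedModule)), Hex.
Qed.

(** * Analyticity in the energy at fixed eccentricity *)

Lemma gap_lower_bound r e p q : (forall z, 0 < gap r e p q z) ->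
  exists m, 0 < m /\ forall z, m <= gap r e p q z.
Proof.
intros Hg.
destruct (continuity_ab_min (gap r e p q) 0 (2 * PI) two_PI_pos) as [z0 [Hz0 _]].
{ intros z _; apply continuity_pt_filterlim.
  apply (ex_derive_continuous (K := R_AbsRing) (V := R_NormedModule)).
  unfold gap; auto_derive; exact I. }
exists (gap r e p q z0); split; [apply Hg |].
intros z.
destruct (angle_of_circle (cos z) (sin z)) as [y [Hy [Hc Hs]]].
{ generalize (sin2_cos2_pow z); nra. }
specialize (Hz0 y Hy); unfold gap in *; rewrite Hc, Hs in Hz0; exact Hz0.
Qed.

Ltac expand_uniform :=
  lazymatch goal with
  | H : uniform_pseries ?f |- uniform_pseries ?f => exact H
  | |- uniform_pseries (fun x z => @?f x z + @?g x z) =>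
      apply (uniform_pseries_plus f g); expand_uniform
  | |- uniform_pseries (fun x z => @?f x z * @?g x z) =>
      apply (uniform_pseries_mult f g); expand_uniform
  | |- uniform_pseries (fun x z => x) => apply uniform_pseries_id
  | |- uniform_pseries _ => apply uniform_pseries_const
  end.

(** The values of [gap] at [q] and [- q] have mean [gap_mean] and product
    [gap_prod], both polynomials in [p] and [Q = q^2]. *)
Definition gap_mean (r e p z : R) : R :=
  r ^ 2 + 2 * r * (p * (cos z - e)) + (1 - e * cos z) ^ 2.

Definition gap_prod (r e p Q z : R) : R :=
  gap_mean r e p z * gap_mean r e p z - 4 * r ^ 2 * Q * (sin z * sin z).

(** The mean of the densities at [q] and [- q], written without [q]: if
    [A] is the mean and [X] the product of the two numbers [D1], [D2], then
    [1 / sqrt D1 + 1 / sqrt D2 = sqrt (2 (A + sqrt X)) / sqrt X].  Square roots are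
    expressed as [y * / sqrt y], so that only inverse square roots occur. *)
Definition even_density (r e p Q z : R) : R :=
  let X := gap_prod r e p Q z in
  let w := / sqrt X in
  let Y := gap_mean r e p z + X * w in
  (1 - e * cos z) * / sqrt 2 * (Y * / sqrt Y) * w.

Lemma gap_mean_prod r e p q z : 
  gap_mean r e p z = (gap r e p q z + gap r e p (- q) z) / 2 /\
  gap_prod r e p (q ^ 2) z = gap r e p q z * gap r e p (- q) z.
Proof. unfold gap_prod, gap_mean, gap; split; field. Qed.

Lemma even_density_correct r e p q z :
  0 < gap r e p q z -> 0 < gap r e p (- q) z ->
  even_density r e p (q ^ 2) z =
  / 2 * (ring_density r e p q z + ring_density r e p (- q) z).
Proof.
intros H1 H2; unfold even_density, ring_density; cbv zeta.
destruct (gap_mean_prod r e p q z) as [-> ->].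
rewrite sqrt_mult by lra.
pose proof (sqrt_lt_R0 _ H1) as P1; pose proof (sqrt_lt_R0 _ H2) as P2.
pose proof (sqrt_sqrt _ (Rlt_le _ _ H1)) as S1; pose proof (sqrt_sqrt _ (Rlt_le _ _ H2)) as S2.
set (u := sqrt (gap r e p q z)) in *; set (v := sqrt (gap r e p (- q) z)) in *.
rewrite <- S1, <- S2.
assert (P3 : 0 < sqrt 2) by (apply sqrt_lt_R0; lra).
assert (S3 : sqrt 2 * sqrt 2 = 2) by (apply sqrt_sqrt; lra).
replace ((u * u + v * v) / 2 + u * u * (v * v) * / (u * v))
  with (((u + v) / sqrt 2) ^ 2).
2:{ replace (((u + v) / sqrt 2) ^ 2) with ((u + v) ^ 2 / (sqrt 2 * sqrt 2)) by (field; lra).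
    rewrite S3; field; lra. }
rewrite sqrt_pow2.
2:{ apply Rlt_le, Rdiv_lt_0_compat; lra. }
transitivity ((1 - e * cos z) * (u + v) / (sqrt 2 * sqrt 2) / (u * v)).
- field; lra.
- rewrite S3; field; lra.
Qed.

Lemma ring_potential_even r e p q : (forall z, 0 < gap r e p q z) ->
  ring_potential r e p q = RInt (even_density r e p (q ^ 2)) 0 (2 * PI).
Proof.
intros Hg.
assert (Hg' : forall z, 0 < gap r e p (- q) z).
{ intros z; specialize (Hg (- z)); unfold gap in *.
  rewrite cos_neg, sin_neg in Hg.
  replace (- q * sin z) with (q * - sin z) by ring; exact Hg. }
transitivity (RInt (fun z => scal (/ 2) (plus (ring_density r e p q z) (ring_density r e p (- q) z))) 0 (2 * PI)).
- assert (X1 : ex_RInt (ring_density r e p q) 0 (2 * PI)) by (apply ex_RInt_ring_density; auto).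
  assert (X2 : ex_RInt (ring_density r e p (- q)) 0 (2 * PI)) by (apply ex_RInt_ring_density; auto).
  symmetry.
  eapply eq_trans; [apply (RInt_scal (V := R_CompleteNormedModule)), (ex_RInt_plus (V := R_NormedModule)); assumption |].
  eapply eq_trans; [apply (f_equal (scal (/ 2))), (RInt_plus (V := R_CompleteNormedModule)); assumption |].
  pose proof (ring_potential_opp r e p q (fun z _ => Hg z)) as Ho.
  change (/ 2 * (ring_potential r e p q + ring_potential r e p (- q)) = ring_potential r e p q).
  rewrite Ho; field.
- apply RInt_ext; intros z _; symmetry; now apply even_density_correct.
Qed.

Lemma even_density_pseries r e p0 p1 (Q : R -> R) q0 :
  (forall z, 0 < gap r e p0 q0 z) -> Q 0 = q0 ^ 2 ->
  uniform_pseries (fun x _ => Q x) ->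
  uniform_pseries (fun x z => even_density r e (p0 + p1 * x) (Q x) z).
Proof.
intros Hg HQ UQ.
destruct (gap_lower_bound r e p0 q0 Hg) as [m [Hm Hmz]].
assert (Hm' : forall z, m <= gap r e p0 (- q0) z).
{ intros z; specialize (Hmz (- z)); unfold gap in *.
  rewrite cos_neg, sin_neg in Hmz.
  replace (- q0 * sin z) with (q0 * - sin z) by ring; exact Hmz. }
assert (Ucos : uniform_pseries (fun _ z => cos z)).
{ apply (uniform_pseries_fun cos 1).
  - intros z; apply continuous_cos.
  - intros z; apply Rabs_le, COS_bound. }
assert (Usin : uniform_pseries (fun _ z => sin z)).
{ apply (uniform_pseries_fun sin 1).
  - intros z; apply continuous_sin.
  - intros z; apply Rabs_le, SIN_bound. }
assert (UN : uniform_pseries (fun _ z => 1 - e * cos z)).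
{ apply (uniform_pseries_ext (fun _ z => 1 + (- e) * cos z)); [intros; ring | expand_uniform]. }
assert (UA : uniform_pseries (fun x z => gap_mean r e (p0 + p1 * x) z)).
{ apply (uniform_pseries_ext (fun x z => r ^ 2 + (2 * r) * ((p0 + p1 * x) * (cos z + - e))
      + (1 - e * cos z) * (1 - e * cos z))).
  - intros; unfold gap_mean; ring.
  - expand_uniform. }
assert (UX : uniform_pseries (fun x z => gap_prod r e (p0 + p1 * x) (Q x) z)).
{ apply (uniform_pseries_ext (fun x z => gap_mean r e (p0 + p1 * x) z * gap_mean r e (p0 + p1 * x) z
      + (- 4 * r ^ 2) * Q x * (sin z * sin z))).
  - intros; unfold gap_prod; ring.
  - expand_uniform. }
assert (X0 : forall z, m * m <= gap_prod r e (p0 + p1 * 0) (Q 0) z).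
{ intros z; rewrite HQ; replace (p0 + p1 * 0) with p0 by ring.
  destruct (gap_mean_prod r e p0 q0 z) as [_ ->].
  apply Rmult_le_compat; auto; lra. }
assert (UR : uniform_pseries (fun x z => / sqrt (gap_prod r e (p0 + p1 * x) (Q x) z))).
{ apply (uniform_pseries_rsqrt _ (m * m)); auto; nra. }
assert (UY : uniform_pseries (fun x z => gap_mean r e (p0 + p1 * x) z
   + gap_prod r e (p0 + p1 * x) (Q x) z * / sqrt (gap_prod r e (p0 + p1 * x) (Q x) z))) by expand_uniform.
assert (UT : uniform_pseries (fun x z => / sqrt (gap_mean r e (p0 + p1 * x) z
   + gap_prod r e (p0 + p1 * x) (Q x) z * / sqrt (gap_prod r e (p0 + p1 * x) (Q x) z)))).
{ apply (uniform_pseries_rsqrt _ m); auto.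
  intros z; specialize (X0 z).
  assert (HX : 0 < gap_prod r e (p0 + p1 * 0) (Q 0) z) by nra.
  pose proof (Rinv_0_lt_compat _ (sqrt_lt_R0 _ HX)).
  assert (0 < gap_prod r e (p0 + p1 * 0) (Q 0) z * / sqrt (gap_prod r e (p0 + p1 * 0) (Q 0) z))
    by now apply Rmult_lt_0_compat.
  assert (m <= gap_mean r e (p0 + p1 * 0) z).
  { replace (p0 + p1 * 0) with p0 by ring.
    destruct (gap_mean_prod r e p0 q0 z) as [-> _].
    specialize (Hmz z); specialize (Hm' z); lra. }
  lra. }
unfold even_density; cbv zeta.
expand_uniform.
Qed.

(** In the variable [x], [p] is affine and [level_Q] quadratic.  The series
    is that of an integral which also makes sense for slightly negative
    [level_Q]; the potential agrees with it where [e] occurs on the level. *)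
Lemma level_potential_pseries r th E lam e :
  0 < r -> noncollision r th E -> inner_level r th E e ->
  exists c rad, 0 < rad /\ forall x, Rabs x < rad ->
    noncollision r th (E + lam * x) -> inner_level r th (E + lam * x) e ->
    is_pseries c x (level_potential r th (E + lam * x) e).
Proof.
intros Hr Hnc Hin.
assert (He := proj1 Hin).
assert (HQ := proj2 (proj2 Hin)).
set (p0 := level_p r E e); set (p1 := lam / (r * e)).
assert (Hp : forall x, level_p r (E + lam * x) e = p0 + p1 * x).
{ intros x; unfold p0, p1, level_p; field; lra. }
set (Q := fun x => level_Q r th (E + lam * x) e).
assert (UQ : uniform_pseries (fun x _ => Q x)).
{ apply (uniform_pseries_ext (fun x _ => (1 - e ^ 2) + - th ^ 2
     + - (1 - e ^ 2) * ((p0 + p1 * x) * (p0 + p1 * x)))).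
  - intros x z; unfold Q, level_Q; rewrite Hp; ring.
  - expand_uniform. }
assert (HQ0 : Q 0 = sqrt (level_Q r th E e) ^ 2).
{ rewrite pow2_sqrt by exact HQ; unfold Q; now rewrite Rmult_0_r, Rplus_0_r. }
assert (Hg : forall z, 0 < gap r e p0 (sqrt (level_Q r th E e)) z).
{ intros z; apply level_gap_pos; auto; now apply inner_level_on_level. }
destruct (uniform_pseries_RInt _ 0 (2 * PI)
  (even_density_pseries r e p0 p1 Q (sqrt (level_Q r th E e)) Hg HQ0 UQ)) as (c & rad & Hrad & Hc).
exists c, rad; split; [exact Hrad |]; intros x Hx Hncx Hinx.
specialize (Hc x Hx).
unfold level_potential; rewrite ring_potential_even.
- rewrite Hp, pow2_sqrt by apply Hinx; exact Hc.
- intros z; apply level_gap_pos; auto; now apply inner_level_on_level.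
Qed.

(** * A choice of eccentricity valid for neighbouring energies *)

Lemma level_p_shift r E E' e : r <> 0 -> e <> 0 ->
  level_p r E' e = level_p r E e + (E' - E) / (r * e).
Proof. intros Hr He; unfold level_p; field; auto. Qed.

Lemma level_Q_le r th E E' e :
  e ^ 2 < 1 -> level_p r E' e ^ 2 <= level_p r E e ^ 2 ->
  level_Q r th E e <= level_Q r th E' e.
Proof. intros He Hp; unfold level_Q; nra. Qed.

Lemma level_Q_lt r th E E' e :
  e ^ 2 < 1 -> level_p r E' e ^ 2 < level_p r E e ^ 2 ->
  level_Q r th E e < level_Q r th E' e.
Proof. intros He Hp; unfold level_Q; nra. Qed.

(** If [q^2] is positive somewhere on the level, that [e] persists by
    continuity.  Otherwise [E] is not strictly between [th^2] and [1] (at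
    [e = sqrt (1 - E)] one would have [0 < q^2]), and [p] is negative for all
    eccentricities if [E <= th^2], positive if [1 <= E].  Moving [E] outwards
    would increase [|p|] and decrease [q^2] everywhere, leaving no
    eccentricity at all; hence the neighbouring attained values lie on the inner
    side, where [|p|] decreases at the given [e]. *)
Lemma stable_eccentricity r th E e1 : 0 < r -> inner_level r th E e1 ->
  exists e d, inner_level r th E e /\ 0 < d /\
    forall E', Rabs (E' - E) < d -> (exists e', inner_level r th E' e') ->
      inner_level r th E' e.
Proof.
intros Hr Hin1.
destruct (classic (exists e, inner_level r th E e /\ 0 < level_Q r th E e))
  as [[e [Hin HQ]] | Hno].
- exists e.
  assert (C : continuous (fun E' => level_Q r th E' e) E).
  { apply (ex_derive_continuous (K := R_AbsRing) (V := R_NormedModule)).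
    unfold level_Q, level_p; auto_derive; exact I. }
  destruct (C (fun y => 0 < y) (open_gt 0 _ HQ)) as [d Hd].
  exists d; split; [exact Hin | split; [apply cond_pos |]].
  intros E' HE' _; split; [apply Hin | split; [apply Hin |]].
  apply Rlt_le, Hd, HE'.
- assert (Hout : E <= th ^ 2 \/ 1 <= E).
  { destruct (Rle_dec E (th ^ 2)) as [H | H]; [now left |].
    destruct (Rle_dec 1 E) as [H' | H']; [now right | exfalso; apply Hno].
    pose proof (pow2_ge_0 th).
    assert (He2 : sqrt (1 - E) ^ 2 = 1 - E) by (apply pow2_sqrt; lra).
    assert (He : 0 < sqrt (1 - E)) by (apply sqrt_lt_R0; lra).
    assert (HQ : 0 < level_Q r th E (sqrt (1 - E))) by (rewrite level_Q_0; lra).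
    exists (sqrt (1 - E)); split; [| exact HQ]; repeat split; lra. }
  assert (Hmax : forall e, 0 < e -> e ^ 2 + th ^ 2 < 1 -> level_Q r th E e <= 0).
  { intros e He Het; apply Rnot_lt_le; intros HQ; apply Hno.
    exists e; repeat split; auto; lra. }
  assert (Hsgn : forall e, 0 < e -> e ^ 2 + th ^ 2 < 1 ->
     0 < (E - (1 - e ^ 2)) * level_p r E e /\ r * e * level_p r E e = E - (1 - e ^ 2)).
  { intros e He Het.
    pose proof (level_p_energy r E e) as HE.
    assert (HE' : r * e * level_p r E e = E - (1 - e ^ 2)) by (generalize (HE ltac:(lra) ltac:(lra)); lra).
    split; [| exact HE'].
    assert (Hre : 0 < r * e) by (apply Rmult_lt_0_compat; assumption).
    pose proof (pow2_ge_0 th); pose proof (pow_lt e 2 He).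
    rewrite <- HE'.
    assert (level_p r E e <> 0) by (intros Z; rewrite Z in HE'; lra).
    assert (0 < level_p r E e ^ 2) by (apply pow2_gt_0; assumption).
    nra. }
  destruct Hin1 as (He1 & Het1 & HQ1).
  set (p1 := level_p r E e1) in *.
  assert (Hd : 0 < Rabs p1 * (r * e1)).
  { destruct (Hsgn e1 He1 Het1) as [H _]; fold p1 in H.
    apply Rmult_lt_0_compat; [| now apply Rmult_lt_0_compat].
    apply Rabs_pos_lt; intros Z; rewrite Z in H; lra. }
  exists e1, (Rabs p1 * (r * e1)); split; [repeat split; assumption |].
  split; [exact Hd |].
  intros E' HE' [e' (He' & Het' & HQ')].
  split; [exact He1 | split; [exact Het1 |]].
  pose proof (pow2_ge_0 th) as Hth.
  pose proof (pow_lt e1 2 He1) as He12; pose proof (pow_lt e' 2 He') as He'2.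
  assert (Hre1 : 0 < r * e1) by (apply Rmult_lt_0_compat; assumption).
  assert (Hre' : 0 < r * e') by (apply Rmult_lt_0_compat; assumption).
  assert (S1 : level_p r E' e1 = p1 + (E' - E) / (r * e1)) by (apply level_p_shift; lra).
  assert (S' : level_p r E' e' = level_p r E e' + (E' - E) / (r * e')) by (apply level_p_shift; lra).
  destruct (Hsgn e1 He1 Het1) as [G1 _]; fold p1 in G1.
  destruct (Hsgn e' He' Het') as [G' _].
  assert (Hcross : level_p r E e' ^ 2 < level_p r E' e' ^ 2 -> False).
  { intros Hlt; specialize (Hmax e' He' Het').
    generalize (level_Q_lt r th E' E e' ltac:(lra) Hlt); lra. }
  apply Rle_trans with (1 := HQ1), level_Q_le; [lra |].
  fold p1; rewrite S1; rewrite S' in Hcross.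
  set (d1 := (E' - E) / (r * e1)) in *; set (d' := (E' - E) / (r * e')) in *.
  assert (Hd1 : d1 * (r * e1) = E' - E) by (unfold d1; field; lra).
  assert (Hd' : d' * (r * e') = E' - E) by (unfold d'; field; lra).
  assert (Hd1b : Rabs d1 < Rabs p1).
  { apply Rmult_lt_reg_r with (r * e1); [exact Hre1 |].
    rewrite <- (Rabs_pos_eq (r * e1)) at 1 by lra.
    rewrite <- Rabs_mult, Hd1; exact HE'. }
  set (p' := level_p r E e') in *.
  destruct Hout as [Hout | Hout].
  + assert (p1 < 0) by nra. assert (p' < 0) by nra.
    rewrite (Rabs_left p1) in Hd1b by lra; apply Rabs_def2 in Hd1b.
    assert (0 <= d').
    { apply Rnot_lt_le; intros Hneg; apply Hcross; nra. }
    assert (0 <= d1) by nra.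
    nra.
  + assert (0 < p1) by nra. assert (0 < p') by nra.
    rewrite (Rabs_pos_eq p1) in Hd1b by lra; apply Rabs_def2 in Hd1b.
    assert (d' <= 0).
    { apply Rnot_lt_le; intros Hneg; apply Hcross; nra. }
    assert (d1 <= 0) by nra.
    nra.
Qed.


(** * The averaged potential as a function of the energy *)

Section Averaged_potential.

Variables m2 M2 : R.
Hypotheses (m2_gt0 : 0 < m2) (M2_gt0 : 0 < M2).

Lemma U_scaled r1 b u v : 0 < b ->
  (forall z, 0 < gap (r1 / b) u 0 v z) ->
  U r1 b u v = / (2 * PI) * / b * ring_potential (r1 / b) u 0 v.
Proof.
intros Hb Hg.
unfold U, ring_potential; rewrite Rmult_assoc; f_equal.
transitivity (RInt (fun z => scal (/ b) (ring_density (r1 / b) u 0 v z)) 0 (2 * PI)).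
- apply RInt_ext; intros z _.
  replace (r1 ^ 2 + b ^ 2 - 2 * b * (r1 * v * sin z + b * u * cos z) + b ^ 2 * u ^ 2 * cos z ^ 2)
    with (b ^ 2 * gap (r1 / b) u 0 v z) by (unfold gap; field; lra).
  specialize (Hg z).
  rewrite sqrt_mult; [| apply pow2_ge_0 | now apply Rlt_le].
  rewrite sqrt_pow2 by now apply Rlt_le.
  pose proof (sqrt_lt_R0 _ Hg).
  change (scal ?x ?y) with (x * y).
  match goal with |- @eq _ ?x ?y => change (@eq R x y) end.
  unfold ring_density; field; lra.
- apply (RInt_scal (V := R_CompleteNormedModule)); apply ex_RInt_ring_density; auto.
Qed.

Lemma E0_value_inner_level r1 L2 Th E : 0 < r1 -> 0 < L2 ->
  let r := r1 / a2 m2 M2 L2 in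
  E0_value m2 M2 r1 L2 Th E <->
  noncollision r (Th / L2) (E / L2 ^ 2) /\
  exists e, inner_level r (Th / L2) (E / L2 ^ 2) e.
Proof.
intros Hr1 HL r; split.
- intros (G2 & g2 & Hadm & <-).
  destruct (admissible_inner_level m2 M2 m2_gt0 M2_gt0 _ _ _ _ _ Hadm) as (_ & Hin & Hnc & _).
  split; [exact Hnc | eexists; exact Hin].
- intros [Hnc [e Hin]].
  destruct (inner_level_admissible m2 M2 m2_gt0 M2_gt0 r1 L2 Th E e Hr1 HL Hin Hnc)
    as (G2 & g2 & Hadm & HE & _).
  now exists G2, g2.
Qed.

Lemma factor_value ht r1 L2 Th E e :
  factors_h2 m2 M2 ht -> 0 < r1 -> 0 < L2 ->
  let r := r1 / a2 m2 M2 L2 in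
  noncollision r (Th / L2) (E / L2 ^ 2) ->
  inner_level r (Th / L2) (E / L2 ^ 2) e ->
  ht r1 L2 Th E =
    / (2 * PI) * / a2 m2 M2 L2 * level_potential r (Th / L2) (E / L2 ^ 2) e.
Proof.
intros Hht Hr1 HL r Hnc Hin.
destruct (inner_level_admissible m2 M2 m2_gt0 M2_gt0 r1 L2 Th E e Hr1 HL Hin Hnc)
  as (G2 & g2 & Hadm & HE & He).
destruct (admissible_inner_level m2 M2 m2_gt0 M2_gt0 _ _ _ _ _ Hadm) as (_ & _ & _ & Hh).
rewrite HE, He in Hh; rewrite <- HE at 1; rewrite <- Hht by exact Hadm; exact Hh.
Qed.

(** Two admissible configurations with the same [E0] lie on one level curve,
    so any choice of a configuration defines the function. *)
Lemma exists_factor : exists ht, factors_h2 m2 M2 ht.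
Proof.
exists (fun r1 L2 Th E => epsilon (inhabits 0) (fun v =>
  exists G2 g2, admissible m2 M2 r1 L2 Th G2 g2 /\ E0 m2 M2 r1 L2 Th G2 g2 = E /\
    v = h2 m2 M2 r1 L2 Th G2 g2)).
intros r1 L2 Th G2 g2 Hadm.
match goal with |- _ = epsilon ?i ?P => destruct (epsilon_spec i P) as (G & g & Hadm' & HE & Hv) end.
{ eexists; exists G2, g2; repeat split; try apply Hadm; reflexivity. }
rewrite Hv; clear Hv.
destruct (admissible_inner_level m2 M2 m2_gt0 M2_gt0 _ _ _ _ _ Hadm) as (HL & Hin & Hnc & ->).
destruct (admissible_inner_level m2 M2 m2_gt0 M2_gt0 _ _ _ _ _ Hadm') as (_ & Hin' & _ & ->).
rewrite HE in *; f_equal.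
apply level_potential_constant; auto using inner_level_on_level.
apply Rdiv_lt_0_compat; [apply Hadm | now apply a2_gt0].
Qed.

Lemma factor_is_U ht r1 L2 Th E :
  factors_h2 m2 M2 ht -> 0 < r1 -> 0 < L2 ->
  E0_value m2 M2 r1 L2 Th E -> Th ^ 2 <= E <= L2 ^ 2 ->
  ht r1 L2 Th E = U r1 (a2 m2 M2 L2) (calE L2 E) (calI L2 Th E).
Proof.
intros Hht Hr1 HL HV HE.
pose proof (a2_gt0 m2 M2 m2_gt0 M2_gt0 L2 HL) as Ha.
assert (Hr : 0 < r1 / a2 m2 M2 L2) by now apply Rdiv_lt_0_compat.
destruct (proj1 (E0_value_inner_level r1 L2 Th E Hr1 HL) HV) as [Hnc [e Hin]].
rewrite (factor_value ht r1 L2 Th E e) by assumption.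
assert (HL2 : 0 < L2 ^ 2) by now apply pow_lt.
assert (HE' : (Th / L2) ^ 2 <= E / L2 ^ 2 <= 1).
{ replace ((Th / L2) ^ 2) with (Th ^ 2 / L2 ^ 2) by (field; lra); split.
  - apply Rmult_le_compat_r; [apply Rlt_le, Rinv_0_lt_compat |]; lra.
  - apply Rmult_le_reg_r with (L2 ^ 2); [exact HL2 |].
    unfold Rdiv; rewrite Rmult_assoc, Rinv_l; lra. }
assert (Hon := on_level_0 (r1 / a2 m2 M2 L2) _ _ HE').
pose proof (level_potential_constant _ _ _ _ _ Hr Hnc (inner_level_on_level _ _ _ _ Hin) Hon) as HU.
assert (Hgap := fun z => level_gap_pos _ _ _ _ z Hr Hnc Hon).
unfold level_potential at 2 in HU.
rewrite level_p_0, level_Q_0 in HU, Hgap by lra.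
assert (HcE : calE L2 E = sqrt (1 - E / L2 ^ 2)).
{ unfold calE; replace (1 - E / L2 ^ 2) with ((L2 ^ 2 - E) / L2 ^ 2) by (field; lra).
  rewrite sqrt_div_alt, sqrt_pow2 by lra; reflexivity. }
assert (HcI : calI L2 Th E = sqrt (E / L2 ^ 2 - (Th / L2) ^ 2)).
{ unfold calI; replace (E / L2 ^ 2 - (Th / L2) ^ 2) with ((E - Th ^ 2) / L2 ^ 2) by (field; lra).
  rewrite sqrt_div_alt, sqrt_pow2 by lra; reflexivity. }
now rewrite HcE, HcI, U_scaled, HU.
Qed.

Lemma factor_analytic ht r1 L2 Th :
  factors_h2 m2 M2 ht -> 0 < r1 -> 0 < L2 ->
  analytic_on (E0_value m2 M2 r1 L2 Th) (ht r1 L2 Th).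
Proof.
intros Hht Hr1 HL E HV.
pose proof (a2_gt0 m2 M2 m2_gt0 M2_gt0 L2 HL) as Ha.
assert (Hr : 0 < r1 / a2 m2 M2 L2) by now apply Rdiv_lt_0_compat.
assert (HL2 : 0 < L2 ^ 2) by now apply pow_lt.
destruct (proj1 (E0_value_inner_level r1 L2 Th E Hr1 HL) HV) as [Hnc [e1 Hin1]].
destruct (stable_eccentricity _ _ _ _ Hr Hin1) as (e & d & Hin & Hd & Hstab).
destruct (level_potential_pseries _ _ _ (/ L2 ^ 2) _ Hr Hnc Hin) as (c & rad & Hrad & Hc).
exists (PS_scal (/ (2 * PI) * / a2 m2 M2 L2) c), (Rmin rad (d * L2 ^ 2)).
split; [apply Rmin_glb_lt; [exact Hrad | now apply Rmult_lt_0_compat] |].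
intros x HVx Hx.
assert (Hx1 := Rlt_le_trans _ _ _ Hx (Rmin_l _ _)).
assert (Hx2 := Rlt_le_trans _ _ _ Hx (Rmin_r _ _)).
destruct (proj1 (E0_value_inner_level r1 L2 Th x Hr1 HL) HVx) as [Hncx Hex].
assert (Hinx : inner_level (r1 / a2 m2 M2 L2) (Th / L2) (x / L2 ^ 2) e).
{ apply Hstab; [| exact Hex].
  replace (x / L2 ^ 2 - E / L2 ^ 2) with ((x - E) / L2 ^ 2) by (field; lra).
  unfold Rdiv; rewrite Rabs_mult, Rabs_inv, (Rabs_pos_eq (L2 ^ 2)) by lra.
  apply Rmult_lt_reg_r with (L2 ^ 2); [exact HL2 |].
  rewrite Rmult_assoc, Rinv_l; lra. }
rewrite (factor_value ht r1 L2 Th x e) by assumption.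
apply (is_pseries_scal (K := R_AbsRing) (V := R_NormedModule)); [apply Rmult_comm |].
specialize (Hc (x - E) Hx1).
replace (E / L2 ^ 2 + / L2 ^ 2 * (x - E)) with (x / L2 ^ 2) in Hc by (field; lra).
now apply Hc.
Qed.

(** [level_Q] decreases by [th^2] when [th] leaves [0]: a point of the planar
    level with [0 < level_Q] remains on the level for small [th], while a level
    without such points disappears for every [th <> 0]. *)
Lemma factor_planar_limit ht r1 L2 E :
  factors_h2 m2 M2 ht -> 0 < r1 -> 0 < L2 -> E0_value m2 M2 r1 L2 0 E ->
  filterlim (fun Th => ht r1 L2 Th E)
    (within (fun Th => E0_value m2 M2 r1 L2 Th E) (locally' 0))
    (locally (ht r1 L2 0 E)).
Proof.
intros Hht Hr1 HL HV.
pose proof (a2_gt0 m2 M2 m2_gt0 M2_gt0 L2 HL) as Ha.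
assert (Hr : 0 < r1 / a2 m2 M2 L2) by now apply Rdiv_lt_0_compat.
set (r := r1 / a2 m2 M2 L2) in *; set (E1 := E / L2 ^ 2).
assert (Hnc : E1 <> r).
{ destruct (proj1 (E0_value_inner_level r1 L2 0 E Hr1 HL) HV) as [[H | H] _].
  - exfalso; apply H; field; lra.
  - exact H. }
assert (HQ0 : forall th e, level_Q r th E1 e = level_Q r 0 E1 e - th ^ 2)
  by (intros; unfold level_Q; ring).
destruct (classic (exists e, 0 < e < 1 /\ 0 < level_Q r 0 E1 e)) as [[e [He HQ]] | Hno].
- assert (Hin : locally 0 (fun Th => inner_level r (Th / L2) E1 e)).
  { assert (C : forall k : R, continuous (fun Th => k - (Th / L2) ^ 2) 0).
    { intros k; apply (ex_derive_continuous (K := R_AbsRing) (V := R_NormedModule)).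
      auto_derive; exact I. }
    assert (P1 : 0 < (1 - e ^ 2) - (0 / L2) ^ 2) by (unfold Rdiv; rewrite Rmult_0_l; nra).
    assert (P2 : 0 < level_Q r 0 E1 e - (0 / L2) ^ 2) by (unfold Rdiv; rewrite Rmult_0_l; nra).
    assert (L1 : locally 0 (fun Th => 0 < (1 - e ^ 2) - (Th / L2) ^ 2))
      by exact (C _ (fun y => 0 < y) (open_gt 0 _ P1)).
    assert (L3 : locally 0 (fun Th => 0 < level_Q r 0 E1 e - (Th / L2) ^ 2))
      by exact (C _ (fun y => 0 < y) (open_gt 0 _ P2)).
    generalize (filter_and _ _ L1 L3).
    apply filter_imp; intros Th [H1 H2]; split; [apply He | split; [lra |]].
    rewrite HQ0; lra. }
  assert (Hval : locally 0 (fun Th => / (2 * PI) * / a2 m2 M2 L2 * level_potential r (Th / L2) E1 e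
     = ht r1 L2 Th E)).
  { revert Hin; apply filter_imp; intros Th Hin.
    symmetry; apply factor_value; auto. now right. }
  cut (filterlim (fun Th => ht r1 L2 Th E) (locally 0) (locally (ht r1 L2 0 E))).
  { intros Hlim P HP; destruct (Hlim P HP) as [d Hd].
    exists d; intros Th HTh _ _; now apply Hd. }
  rewrite <- (locally_singleton _ _ Hval).
  eapply filterlim_ext_loc; [exact Hval |].
  apply (continuous_scal_r (K := R_AbsRing) (V := R_NormedModule)
           (/ (2 * PI) * / a2 m2 M2 L2) (fun Th => level_potential r (Th / L2) E1 e) 0).
  apply (ring_potential_continuous r (fun _ => e) (fun _ => level_p r E1 e)
           (fun Th => sqrt (level_Q r (Th / L2) E1 e))).
  + apply continuous_const.
  + apply continuous_const.
  + apply (continuous_comp (fun Th => level_Q r (Th / L2) E1 e) sqrt); [| apply continuous_sqrt].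
    apply (ex_derive_continuous (K := R_AbsRing) (V := R_NormedModule)).
    unfold level_Q; auto_derive; exact I.
  + intros z _; apply level_gap_pos; [exact Hr | now right |].
    apply inner_level_on_level, (locally_singleton _ _ Hin).
- intros P _; exists (mkposreal 1 Rlt_0_1); intros Th _ HTh HVTh; exfalso.
  destruct (proj1 (E0_value_inner_level r1 L2 Th E Hr1 HL) HVTh) as [_ (e & He & Het & HQ)].
  fold r E1 in HQ; rewrite HQ0 in HQ.
  assert (Hth : 0 < (Th / L2) ^ 2).
  { apply pow2_gt_0; unfold Rdiv; apply Rmult_integral_contrapositive_currified; [exact HTh |].
    apply Rinv_neq_0_compat; lra. }
  apply Hno; exists e; split; [split; [exact He | nra] | lra].
Qed.

End Averaged_potential.

Theorem proposition8 (m2 M2 : R) (m2_gt0 : 0 < m2) (M2_gt0 : 0 < M2) :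
  (exists ht : R -> R -> R -> R -> R, factors_h2 m2 M2 ht) /\
  (forall ht : R -> R -> R -> R -> R,
     factors_h2 m2 M2 ht -> continued_U m2 M2 ht).
Proof.
split; [now apply exists_factor |].
intros ht Hht r1 L2 Hr1 HL; split; [| split].
- intros Th E HV HE; now apply factor_is_U.
- intros Th; now apply factor_analytic.
- intros E HV; now apply factor_planar_limit.
Qed.
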